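(* Let $(\mathcal{E},\circ)$ be a Euclidean Jordan algebra of rank $r$, let $k\in\{1,\dots,r\}$, and let $\lambda_k:\mathcal{E}\to\mathbb{R}$ be the function that maps an element to its $k$-th largest eigenvalue. Let $\mathcal{I}$ denote the set of primitive idempotents of $\mathcal{E}$. Then for every $x\in\mathcal{E}$: $$\partial_C\lambda_k(x)=\operatorname{conv}\{c\in\mathcal{I}\mid x\circ c=\lambda_k(x)c\},$$ $$\hat\partial\lambda_k(x)=\begin{cases}\partial_C\lambda_k(x),&\text{if }k=1\text{ or }\lambda_{k-1}(x)>\lambda_k(x),\\ \emptyset,&\text{otherwise,}\end{cases}$$ $$\partial^\infty\lambda_k(x)=\{0\},$$ $$\partial\lambda_k(x)=\{s\in\partial_C\lambda_k(x)\mid\operatorname{rank}s\le\alpha\},$$ where $\alpha=1-k+|\{i\mid\lambda_i(x)\ge\lambda_k(x)\}|$. Here $\partial_C$, $\hat\partial$, $\partial^\infty$, $\partial$ denote the Clarke, regular, horizon and approximate subdifferentials respectively.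
   Context: Euclidean Jordan algebras. A Euclidean Jordan algebra $(\mathcal{E},\circ)$ is a finite-dimensional real vector space with a bilinear product $\circ$ and an inner product $\langle\cdot,\cdot\rangle$ such that $x\circ y=y\circ x$, $x\circ(x^2\circ y)=x^2\circ(x\circ y)$ (with $x^2=x\circ x$), and $\langle x\circ y,z\rangle=\langle x,y\circ z\rangle$; it has an identity element $e$. An idempotent is $c$ with $c\circ c=c$; a nonzero idempotent is primitive if it is not a sum of two nonzero idempotents $\hat c,\tilde c$ with $\hat c\circ\tilde c=0$. A Jordan frame is an ordered tuple $J=[c_1,\dots,c_r]$ of primitive idempotents with $c_i\circ c_j=0$ for $i\ne j$ and $c_1+\dots+c_r=e$; all Jordan frames have the same length $r$, the rank of $\mathcal{E}$. By the spectral theorem every $x$ is $\sum_i\alpha_ic_i$ for some Jordan frame, with the real numbers $\alpha_i$ (the eigenvalues of $x$) unique up to order; $\lambda_1(x)\ge\dots\ge\lambda_r(x)$ are the eigenvalues of $x$ in nonincreasing order (with multiplicity), and $\operatorname{rank}x$ is the number of nonzero $\alpha_i$. $\operatorname{tr}(x)=\sum_i\lambda_i(x)$. The inner product is taken to be $\langle x,y\rangle=\operatorname{tr}(x\circ y)$, with norm $\|x\|=\sqrt{\operatorname{tr}(x^2)}$. Subdifferentials. Let $g:\mathcal{E}\to\mathbb{R}$ and $x\in\mathcal{E}$. - $s\in\hat\partial g(x)$ iff $\liminf_{z\to0,\,z\ne0}\frac{g(x+z)-g(x)-\langle s,z\rangle}{\|z\|}\ge0$. - $s\in\partial g(x)$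 iff there are sequences $x^k\to x$, $s^k\to s$ with $g(x^k)\to g(x)$ and $s^k\in\hat\partial g(x^k)$ for all $k$. - $s\in\partial^\infty g(x)$ iff there are sequences $x^k\to x$, $s^k\in\hat\partial g(x^k)$, and $t^k\downarrow0$ (all $t^k>0$, nonincreasing, converging to $0$) with $g(x^k)\to g(x)$ and $t^ks^k\to s$. - For a locally Lipschitz $g$ (each $\lambda_k$ is Lipschitz with constant $1$), the Clarke subdifferential is $\partial_C g(x)=\operatorname{conv}\partial g(x)$. *)

(* Defs.v *)
From HB Require Import structures.
From mathcomp Require Import all_boot all_order all_algebra sesquilinear.
From mathcomp Require Import all_classical all_reals all_analysis.

Set Implicit Arguments.
Unset Strict Implicit.
Unset Printing Implicit Defensive.

Import Order.TTheory GRing.Theory Num.Theory.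
Import numFieldNormedType.Exports.
Local Open Scope classical_set_scope.
Local Open Scope ring_scope.

(* The topology of [E] is that of the Jordan norm: [normedModType] supplies it,
   and [jdot_norm] ties the norm to the inner product. *)
HB.mixin Record isEuclideanJordan (R : realType) (E : Type)
    of @Vector R E & NormedModule R E := {
  jmul : {bilinear E -> E -> E};
  jdot : {dot E for (@idfun R)};
  junit : E;
  jmulC : forall x y : E, jmul x y = jmul y x;
  jordan_identity : forall x y : E,
    jmul x (jmul (jmul x x) y) = jmul (jmul x x) (jmul x y);
  jdot_norm : forall x : E, `|x| = Num.sqrt (jdot x x);
  jdot_mul : forall x y z : E, jdot (jmul x y) z = jdot x (jmul y z);
  jmul1x : forall x : E, jmul junit x = x
}.

#[short(type="euclideanJordanType")]
HB.structure Definition EuclideanJordan (R : realType) :=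
  {E of isEuclideanJordan R E & @Vector R E & NormedModule R E}.

Section EuclideanJordanAlgebra.
Context {R : realType} {E : euclideanJordanType R}.
Implicit Types (x y c s : E).

Definition idempotent c : Prop := jmul c c = c.

Definition primitive_idempotent c : Prop :=
  [/\ idempotent c, c != 0 &
      ~ exists c1 c2 : E,
          [/\ idempotent c1 /\ c1 != 0, idempotent c2 /\ c2 != 0,
              jmul c1 c2 = 0 & c = c1 + c2]].

Definition jordan_frame (r : nat) (c : 'I_r -> E) : Prop :=
  [/\ forall i, primitive_idempotent (c i),
      forall i j, i != j -> jmul (c i) (c j) = 0 &
      \sum_(i < r) c i = junit].

Definition has_spectrum x (a : seq R) : Prop :=
  exists c : 'I_(size a) -> E,
    jordan_frame c /\ x = \sum_(i < size a) a`_i *: c i.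

(* [eigvals x] lists the eigenvalues with multiplicity, in nonincreasing order.
   By the spectral theorem the set below is a singleton, so that the default
   value [[::]] is never used and the choice made by [xget] is immaterial. *)
Definition eigvals x : seq R :=
  xget [::] [set a | sorted >=%R a /\ has_spectrum x a].

(* As in the usual notation, eigenvalues are numbered from 1. *)
Definition lambda (k : nat) x : R := (eigvals x)`_k.-1.

Definition elt_rank x : nat := count (fun a => a != 0) (eigvals x).

Definition jtr x : R := \sum_(a <- eigvals x) a.

Definition regular_subdiff (g : E -> R) x : set E :=
  [set s | (0 <= limf_einf
     (fun z : E => ((g (x + z) - g x - jdot s z) / `|z|)%:E) (0%R : E)^')%E].

Definition approx_subdiff (g : E -> R) x : set E :=
  [set s | exists (u v : nat -> E),
     [/\ u @ \oo --> x, v @ \oo --> s, g \o u @ \oo --> g x &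
         forall n, regular_subdiff g (u n) (v n)]].

Definition horizon_subdiff (g : E -> R) x : set E :=
  [set s | exists (u v : nat -> E) (t : nat -> R),
     [/\ u @ \oo --> x /\ g \o u @ \oo --> g x,
         forall n, regular_subdiff g (u n) (v n),
         [/\ forall n, 0 < t n, nonincreasing_seq t & t @ \oo --> 0] &
         (fun n => t n *: v n) @ \oo --> s]].

Definition convex_hull (S : set E) : set E := smallest (@convex_set R E) S.

(* This is the Clarke subdifferential for locally Lipschitz [g] only. *)
Definition clarke_subdiff (g : E -> R) x : set E := convex_hull (approx_subdiff g x).

End EuclideanJordanAlgebra.

(* All Jordan frames have the same length, so the choice is immaterial. *)
Definition jrank {R : realType} (E : euclideanJordanType R) : nat :=
  xget 0%N [set r | exists c : 'I_r -> E, jordan_frame c].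

(* Main.v *)
(* The k-th eigenvalue is a difference of two Ky Fan sums: sigma_k(x), the sum of the k largest
   eigenvalues, is the maximum of <x, u> over the idempotents u of trace k.

   Let C(x) be the set of s that are nonnegative on idempotents, have trace 1 and satisfy
   x s = lambda_k(x) s. Refining Jordan frames shows that C(x) is the convex hull of the primitive
   idempotents c with x c = lambda_k(x) c. If lambda_(k-1)(x) > lambda_k(x), the maximizer defining
   sigma_(k-1)(x) is unique with a quadratic margin; this gives the lower bound
   lambda_k(x + z) >= lambda_k(x) + <s, z> - K |z|^2 for s in C(x), and the upper bound
   lambda_k(x - t d) <= lambda_k(x) + O(t^2) for idempotents d, so that a regular subgradient is
   nonnegative; moving along the identity and along a frame of x then puts it in C(x). If
   lambda_(k-1)(x) = lambda_k(x), moving along a frame of x gives a regular subgradient trace 1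
   and nonpositive diagonal entries, which is absurd.

   The approximate subdifferential is obtained by closedness of C(x) (eigenvalues are Lipschitz),
   the rank of an element of C(x) being bounded by the multiplicity of lambda_k(x). Conversely, if
   s in C(x) has rank at most alpha, slightly raising well-chosen eigenvalues of x in a common
   frame of x and s makes lambda_k the first eigenvalue of its block, and s becomes regular. *)

Require Import Defs.
From HB Require Import structures.
From mathcomp Require Import all_boot all_order all_algebra sesquilinear.
From mathcomp Require Import all_classical all_reals all_analysis.
From mathcomp Require Import perm complex ring lra zify.

Set Implicit Arguments.
Unset Strict Implicit.
Unset Printing Implicit Defensive.

Import Order.TTheory GRing.Theory Num.Theory.
Import numFieldNormedType.Exports.
Local Open Scope classical_set_scope.
Local Open Scope ring_scope.

Local Notation "x ∘ y" := (jmul x y) (at level 40, left associativity).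
Local Notation "'[ x , y ]" := (jdot x y) : ring_scope.
Local Notation idem := Defs.idempotent.

(** * Bilinearity rules, the inner product, and polarization of the Jordan identity *)

Section Algebra.
Context {R : realType} {E : euclideanJordanType R}.
Implicit Types (x y z u v w c d : E) (a b : R).

Lemma jmulDl x y z : (x + y) ∘ z = x ∘ z + y ∘ z. Proof. exact: linearDl. Qed.
Lemma jmulDr x y z : z ∘ (x + y) = z ∘ x + z ∘ y. Proof. exact: linearDr. Qed.
Lemma jmulNl x z : (- x) ∘ z = - (x ∘ z). Proof. exact: linearNl. Qed.
Lemma jmulNr x z : z ∘ (- x) = - (z ∘ x). Proof. exact: linearNr. Qed.
Lemma jmulBr x y z : z ∘ (x - y) = z ∘ x - z ∘ y. Proof. exact: linearBr. Qed.
Lemma jmulBl x y z : (x - y) ∘ z = x ∘ z - y ∘ z. Proof. exact: linearBl. Qed.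
Lemma jmulZl a x z : (a *: x) ∘ z = a *: (x ∘ z). Proof. exact: linearZl_LR. Qed.
Lemma jmulZr a x z : z ∘ (a *: x) = a *: (z ∘ x). Proof. exact: linearZr_LR. Qed.
Lemma jmul0l x : 0 ∘ x = 0. Proof. exact: linear0l. Qed.
Lemma jmul0r x : x ∘ 0 = 0. Proof. exact: linear0r. Qed.
Lemma jmul_suml I (r : seq I) (P : pred I) (F : I -> E) x :
  (\sum_(i <- r | P i) F i) ∘ x = \sum_(i <- r | P i) (F i ∘ x).
Proof. exact: linear_sumlz. Qed.
Lemma jmul_sumr I (r : seq I) (P : pred I) (F : I -> E) x :
  x ∘ (\sum_(i <- r | P i) F i) = \sum_(i <- r | P i) (x ∘ F i).
Proof. exact: linear_sumr. Qed.
Lemma jmulx1 x : x ∘ junit = x. Proof. by rewrite jmulC jmul1x. Qed.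

Lemma jdotDl x y z : '[x + y, z] = '[x, z] + '[y, z]. Proof. exact: linearDl. Qed.
Lemma jdotDr x y z : '[z, x + y] = '[z, x] + '[z, y]. Proof. exact: linearDr. Qed.
Lemma jdotNl x z : '[- x, z] = - '[x, z]. Proof. exact: linearNl. Qed.
Lemma jdotNr x z : '[z, - x] = - '[z, x]. Proof. exact: linearNr. Qed.
Lemma jdotBl x y z : '[x - y, z] = '[x, z] - '[y, z]. Proof. exact: linearBl. Qed.
Lemma jdotBr x y z : '[z, x - y] = '[z, x] - '[z, y]. Proof. exact: linearBr. Qed.
Lemma jdotZl a x z : '[a *: x, z] = a * '[x, z]. Proof. exact: linearZl_LR. Qed.
Lemma jdotZr a x z : '[z, a *: x] = a * '[z, x].
Proof. by rewrite [LHS]linearZr_LR. Qed.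
Lemma jdot0l x : '[0, x] = 0. Proof. exact: linear0l. Qed.
Lemma jdot0r x : '[x, 0] = 0. Proof. exact: linear0r. Qed.
Lemma jdot_suml I (r : seq I) (P : pred I) (F : I -> E) x :
  '[\sum_(i <- r | P i) F i, x] = \sum_(i <- r | P i) '[F i, x].
Proof. exact: linear_sumlz. Qed.
Lemma jdot_sumr I (r : seq I) (P : pred I) (F : I -> E) x :
  '[x, \sum_(i <- r | P i) F i] = \sum_(i <- r | P i) '[x, F i].
Proof. exact: linear_sumr. Qed.

Lemma jdotC x y : '[x, y] = '[y, x].
Proof. by have := hermitian_subproof (s := jdot) x y; rewrite expr0 mul1r. Qed.

Definition jdotE := (jdotDl, jdotDr, jdotNl, jdotNr, jdotZl, jdotZr).

Lemma jdot_gt0 x : x != 0 -> 0 < '[x, x].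
Proof. exact: neq0_dnorm_gt0. Qed.

Lemma jdot_ge0 x : 0 <= '[x, x].
Proof. by have [->|/jdot_gt0/ltW//] := eqVneq x 0; rewrite jdot0l. Qed.

Lemma jdot_eq0 x : '[x, x] = 0 -> x = 0.
Proof. by apply: contra_eq => /jdot_gt0; rewrite lt0r => /andP[]. Qed.

Lemma jdot_ext x y : (forall w, '[x, w] = '[y, w]) -> x = y.
Proof.
by move=> h; apply/eqP; rewrite -subr_eq0; apply/eqP/jdot_eq0; rewrite jdotBl h subrr.
Qed.

Lemma normE x : `|x| ^+ 2 = '[x, x].
Proof. by rewrite jdot_norm sqr_sqrtr// jdot_ge0. Qed.

Lemma jdot_le x y : `|'[x, y]| <= `|x| * `|y|.
Proof.
rewrite -(@ler_pXn2r _ 2) ?nnegrE ?mulr_ge0// real_normK ?num_real// exprMn !normE.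
have [->|/jdot_gt0 y0] := eqVneq y 0; first by rewrite jdot0r expr0n jdot0r mulr0.
have := jdot_ge0 ('[y, y] *: x - '[x, y] *: y).
rewrite !jdotE (jdotC y x); set p := '[x, y]; set q := '[x, x]; set s := '[y, y] in y0 *.
move=> h; have : 0 <= s * (q * s - p ^+ 2) by move: h; rewrite expr2; lra.
by rewrite pmulr_rge0// subr_ge0.
Qed.

Lemma jmul_selfadj x y z : '[x ∘ y, z] = '[y, x ∘ z].
Proof. by rewrite jmulC jdot_mul. Qed.

(** Polarization: half the difference of the Jordan identity at [x + z] and [x - z], minus the
    identity at [z], is its part quadratic in [x] and linear in [z]. Pairing with an arbitrary [w]
    reduces this to linear arithmetic over the reals. *)
Lemma jordan_quad x z d :
  2 *: (x ∘ ((x ∘ z) ∘ d)) + z ∘ ((x ∘ x) ∘ d) =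
  2 *: ((x ∘ z) ∘ (x ∘ d)) + (x ∘ x) ∘ (z ∘ d).
Proof.
apply: jdot_ext => w.
pose g u := '[u ∘ ((u ∘ u) ∘ d) - (u ∘ u) ∘ (u ∘ d), w].
have g0 u : g u = 0 by rewrite /g jordan_identity subrr jdot0l.
pose p (a b c : E) := '[a ∘ ((b ∘ c) ∘ d), w].
pose q (a b c : E) := '[(b ∘ c) ∘ (a ∘ d), w].
have gE t u : g (t + u) = p t t t + p t t u + p t u t + p t u u + p u t t + p u t u
    + p u u t + p u u u - (q t t t + q t t u + q t u t + q t u u + q u t t + q u t u
    + q u u t + q u u u).
  by rewrite /g /p /q !(jmulDl, jmulDr) !(jdotBl, jdotDl); ring.
have pN (a b c : E) : (p (- a) b c = - p a b c) * (p a (- b) c = - p a b c)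
    * (p a b (- c) = - p a b c) * (q (- a) b c = - q a b c) * (q a (- b) c = - q a b c)
    * (q a b (- c) = - q a b c).
  by rewrite /p /q !(jmulNl, jmulNr) !jdotNl.
have pC (a b c : E) : (p a b c = p a c b) * (q a b c = q a c b).
  by rewrite /p /q (jmulC b c).
have := (g0 (x + z), g0 (x + - z), g0 z).
rewrite !gE !pN (pC x z x).1 (pC x z x).2 (pC z z x).1 (pC z z x).2.
have -> : g z = p z z z - q z z z by rewrite /g jdotBl.
rewrite !(jdotDl, jdotZl) -/(p x x z) -/(p z x x) -/(q x x z) -/(q z x x).
move: (p x x x) (p x x z) (p x z z) (p z x x) (p z x z) (p z z z).
move: (q x x x) (q x x z) (q x z z) (q z x x) (q z x z) (q z z z).
by move=> ? ? ? ? ? ? ? ? ? ? ? ? [[]]; lra.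
Qed.

(** Polarizes [jordan_quad] once more: its instances at [x + y], [x] and [y] leave the mixed
    part. *)
Lemma jordan_cubic x y z d :
  x ∘ ((y ∘ z) ∘ d) + y ∘ ((x ∘ z) ∘ d) + z ∘ ((x ∘ y) ∘ d) =
  (y ∘ z) ∘ (x ∘ d) + (x ∘ z) ∘ (y ∘ d) + (x ∘ y) ∘ (z ∘ d).
Proof.
apply: jdot_ext => w.
have h u : '[2 *: (u ∘ ((u ∘ z) ∘ d)) + z ∘ ((u ∘ u) ∘ d), w] =
  '[2 *: ((u ∘ z) ∘ (u ∘ d)) + (u ∘ u) ∘ (z ∘ d), w] by rewrite jordan_quad.
move: (h (x + y)) (h x) (h y); rewrite !(jmulDl, jmulDr) (jmulC y x).
rewrite !(jdotDl, jdotZl).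
move: '[x ∘ ((y ∘ z) ∘ d), w] '[y ∘ ((x ∘ z) ∘ d), w] '[z ∘ ((x ∘ y) ∘ d), w]
 '[(y ∘ z) ∘ (x ∘ d), w] '[(x ∘ z) ∘ (y ∘ d), w] '[(x ∘ y) ∘ (z ∘ d), w]
 '[x ∘ ((x ∘ z) ∘ d), w] '[y ∘ ((y ∘ z) ∘ d), w] '[z ∘ ((x ∘ x) ∘ d), w]
 '[z ∘ ((y ∘ y) ∘ d), w] '[(x ∘ z) ∘ (x ∘ d), w] '[(y ∘ z) ∘ (y ∘ d), w]
 '[(x ∘ x) ∘ (z ∘ d), w] '[(y ∘ y) ∘ (z ∘ d), w] => *; lra.
Qed.

(* The linearized identity, read as an operator identity in its last slot. *)
Lemma jmul3 x y d z : ((x ∘ y) ∘ d) ∘ z =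
  (x ∘ y) ∘ (d ∘ z) + (x ∘ d) ∘ (y ∘ z) + (y ∘ d) ∘ (x ∘ z)
  - x ∘ (d ∘ (y ∘ z)) - y ∘ (d ∘ (x ∘ z)).
Proof.
have := jordan_cubic x y z d.
rewrite (jmulC z (_ ∘ d)) (jmulC (y ∘ z) d) (jmulC (x ∘ z) d) (jmulC z d).
rewrite (jmulC (y ∘ z) (x ∘ d)) (jmulC (x ∘ z) (y ∘ d)) => h.
apply: jdot_ext => w; move: (congr1 (jdot^~ w) h); rewrite !jdotE; lra.
Qed.

End Algebra.

(** * Self-adjoint operators *)

Section PolynomialAction.
Context {R : realType} {E : euclideanJordanType R}.
Variable T : {linear E -> E}.
Implicit Types (v w : E) (p q : {poly R}) (a b : R).

(** This is p(T) v. *)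
Definition pact p v := \sum_(i < size p) p`_i *: iter i T v.

Lemma pactE n p v : (size p <= n)%N -> pact p v = \sum_(i < n) p`_i *: iter i T v.
Proof.
move=> le_n; rewrite /pact (big_ord_widen n (fun i => p`_i *: iter i T v) le_n).
rewrite big_mkcond; apply: eq_bigr => i _; case: ltnP => // le_i.
by rewrite nth_default// scale0r.
Qed.

Lemma pactD p q v : pact (p + q) v = pact p v + pact q v.
Proof.
rewrite (pactE v (size_polyD p q)) (pactE v (leq_maxl (size p) (size q))).
rewrite (pactE v (leq_maxr (size p) (size q))) -big_split /=.
by apply: eq_bigr => i _; rewrite coefD scalerDl.
Qed.

Lemma pactMX p v : pact (p * 'X) v = pact p (T v).
Proof.
have le_s : (size (p * 'X)%R <= (size p).+1)%N.
  by have [->|p0] := eqVneq p 0; rewrite ?mul0r ?size_poly0 ?size_mulX.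
rewrite (pactE v le_s) big_ord_recl coefMX /= scale0r add0r.
by apply: eq_bigr => i _; rewrite coefMX /= -iterS iterSr.
Qed.

Lemma pactC a v : pact a%:P v = a *: v.
Proof. by rewrite (pactE v (size_polyC_leq1 a)) big_ord1 coefC. Qed.

Lemma pactZ a p v : pact (a *: p) v = a *: pact p v.
Proof.
rewrite (pactE v (size_scale_leq a p)) /pact scaler_sumr.
by apply: eq_bigr => i _; rewrite coefZ scalerA.
Qed.

Lemma pactM p q v : pact (p * q) v = pact p (pact q v).
Proof.
elim/poly_ind: p q v => [|p a IHp] q v.
  by rewrite mul0r /pact size_poly0 !big_ord0.
rewrite mulrDl -mulrA (mulrC 'X) mulrA pactD [in RHS]pactD pactMX.
rewrite pactMX !IHp mul_polyC pactZ pactC; congr (pact p _ + _).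
elim/poly_ind: q v => [|q b IHq] v; first by rewrite /pact size_poly0 !big_ord0 linear0.
by rewrite !pactD linearD !pactMX IHq !pactC linearZ_LR.
Qed.

Lemma pact0 p : pact p 0 = 0.
Proof. by rewrite /pact big1// => i _; rewrite iter_fix ?linear0// scaler0. Qed.

Lemma pactXsubC a v : pact ('X - a%:P) v = T v - a *: v.
Proof. by rewrite -polyCN pactD -[X in pact X](mul1r 'X) pactMX !pactC scale1r scaleNr. Qed.

(** The first [dim E + 1] iterates of [v] under [T] are linearly dependent; a dependence gives the
    coefficients of [p]. *)
Lemma exists_annihilator v : exists2 p, p != 0 & pact p v = 0.
Proof.
pose X := [tuple iter i T v | i < (dim E).+1].
have XE (i : 'I_(dim E).+1) : X`_i = iter i T v by rewrite -tnth_nth tnth_mktuple.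
have : ~~ free X.
  apply/negP => /eqP; rewrite size_tuple => dX.
  by have := dimvS (subvf <<X>>%VS); rewrite dX dimvf ltnn.
move=> /freeP nfX.
have [k [sumk [i ki]]] : exists k : 'I_(dim E).+1 -> R,
    \sum_i k i *: X`_i = 0 /\ exists i, k i != 0.
  apply: contrapT => hk; apply: nfX => k sumk i; apply: contrapT => /eqP ki.
  by apply: hk; exists k; split => //; exists i.
pose p := \poly_(j < (dim E).+1) k (inord j).
have pE (j : 'I_(dim E).+1) : p`_j = k j by rewrite coef_poly ltn_ord inord_val.
exists p.
  by apply: contra_neq ki => p0; rewrite -pE p0 coef0.
rewrite (pactE v (size_poly _ _)) -[RHS]sumk.
by apply: eq_bigr => j _; rewrite pE XE.
Qed.

End PolynomialAction.

(** Over R[i] the polynomial splits and, being real, equals its conjugate; multiplying the two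
    factorizations pairs each root with its own conjugate. Squaring [p] avoids matching the nonreal
    roots among themselves. *)
Lemma poly_sqr_factor (R : rcfType) (p : {poly R}) : exists s : seq R[i],
  p * p = lead_coef p ^+ 2 *:
    \prod_(z <- s) (('X - (complex.Re z)%:P) ^+ 2 + (complex.Im z ^+ 2)%:P).
Proof.
pose f := real_complex R; pose pC := map_poly f p.
have [s pE] := closed_field_poly_normal pC; exists s.
have lcE : lead_coef pC = f (lead_coef p).
  by rewrite lead_coef_map_inj//; exact: complexI.
rewrite lcE in pE.
have pJ : pC = f (lead_coef p) *: \prod_(z <- s) ('X - (conjc z)%:P).
  rewrite -[LHS](_ : map_poly conjc pC = _); last first.
    by rewrite /pC -map_poly_comp; apply: eq_map_poly => a /=; rewrite oppr0.
  rewrite [in LHS]pE linearZ_LR/= rmorph_prod; congr (_ *: _); first exact: conjc_real.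
  by apply: eq_bigr => z _; rewrite /= map_polyXsubC.
apply: (@map_poly_inj _ _ f); rewrite rmorphM/= -/pC.
rewrite {1}pE pJ -scalerAl -scalerAr scalerA -big_split /=.
rewrite linearZ_LR/= rmorphXn rmorph_prod expr2 /=; congr (_ *: _).
apply: eq_bigr => -[a b] _.
rewrite rmorphD rmorphXn rmorphB/= map_polyX !map_polyC /=.
pose z : R[i] := Complex 0 b.
have -> : Complex a b = f a + z by apply/eqP; rewrite eq_complex /= addr0 add0r !eqxx.
have -> : Complex a (- b) = f a - z.
  by apply/eqP; rewrite eq_complex /= oppr0 addr0 add0r !eqxx.
have -> : (b ^+ 2)%:C%C = - (z * z).
  apply/eqP; rewrite eq_complex /= !mul0r !mulr0 sub0r addr0 opprK oppr0 expr2.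
  by rewrite !eqxx.
by rewrite polyCD polyCB polyCN polyCM; ring.
Qed.

Section SelfAdjoint.
Context {R : realType} {E : euclideanJordanType R}.
Variable T : {linear E -> E}.
Hypothesis T_selfadj : forall u v : E, '[T u, v] = '[u, T v].
Implicit Types (v w : E) (p q : {poly R}) (a b : R).

(** With y = q(T) v and u = (T - a) y, pairing the hypothesis with y gives |u|^2 + b^2 |y|^2 = 0 by
    self-adjointness. This linearizes the quadratic factors of [poly_sqr_factor] and, for b = 0,
    removes repeated linear ones. *)
Lemma pact_quad_linear q a b v :
  pact T (q * (('X - a%:P) ^+ 2 + (b ^+ 2)%:P)) v = 0 ->
  pact T (q * ('X - a%:P)) v = 0.
Proof.
rewrite mulrC [in X in _ -> X]mulrC !pactM; set y := pact T q v.
rewrite pactD expr2 pactM pactC !pactXsubC; set u := T y - a *: y => uy.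
apply: jdot_eq0; have : '[T u - a *: u + b ^+ 2 *: y, y] = 0 by rewrite uy jdot0l.
have -> : '[T u - a *: u + b ^+ 2 *: y, y] = '[u, u] + b ^+ 2 * '[y, y].
  rewrite [in RHS]/u jdotBr jdotZr !(jdotDl, jdotNl, jdotZl) T_selfadj.
  by rewrite -!(jdotDl, jdotNl, jdotZl).
have uu := jdot_ge0 u; have yy : 0 <= b ^+ 2 * '[y, y] by rewrite mulr_ge0 ?sqr_ge0 ?jdot_ge0.
lra.
Qed.

Lemma pact_prod_linear (s : seq R[i]) q v :
  pact T (q * \prod_(z <- s) (('X - (complex.Re z)%:P) ^+ 2 + (complex.Im z ^+ 2)%:P)) v = 0 ->
  pact T (q * \prod_(z <- s) ('X - (complex.Re z)%:P)) v = 0.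
Proof.
elim: s q => [|z s IHs] q; first by rewrite !big_nil.
rewrite !big_cons mulrA => /IHs; rewrite mulrAC => /pact_quad_linear.
by rewrite mulrAC mulrA.
Qed.

Lemma pact_undup (s : seq R) q v :
  pact T (q * \prod_(a <- s) ('X - a%:P)) v = 0 ->
  pact T (q * \prod_(a <- undup s) ('X - a%:P)) v = 0.
Proof.
elim: s q => [|a s IHs] q //=; rewrite big_cons mulrA => /IHs.
case: ifPn => [as_ |_]; last by rewrite big_cons mulrA.
have au : a \in undup s by rewrite mem_undup.
rewrite (big_rem _ au) /= => h.
rewrite mulrCA mulrC; apply: (@pact_quad_linear _ _ 0).
by rewrite expr0n addr0 expr2 mulrA mulrC mulrA -!mulrA (mulrCA _ q) in h *.
Qed.

Lemma selfadj_real_annihilator v :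
  exists2 s : seq R, uniq s & pact T (\prod_(a <- s) ('X - a%:P)) v = 0.
Proof.
have [p p0 pv] := exists_annihilator T v.
have [s pE] := poly_sqr_factor p.
exists (undup [seq complex.Re z | z <- s]); first exact: undup_uniq.
rewrite -[X in pact T X]mul1r; apply: pact_undup; rewrite big_map.
apply: pact_prod_linear; rewrite mul1r.
apply: (scalerI (_ : lead_coef p ^+ 2 != 0)); first by rewrite expf_neq0 ?lead_coef_eq0.
by rewrite scaler0 -pactZ -pE pactM pv pact0.
Qed.

(** Induction on [s]: (T - a) v is killed by the remaining factors; dividing its component for b by
    b - a gives that of [v], and the rest of [v] is the component for a. All components stay in the
    [T]-stable subspace [M], which later carries commutation relations. *)
Lemma eigen_decomposition (M : E -> Prop) (s : seq R) v :
  (forall u w, M u -> M w -> M (u + w)) -> (forall a u, M u -> M (a *: u)) ->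
  (forall u, M u -> M (T u)) -> uniq s -> M v ->
  pact T (\prod_(a <- s) ('X - a%:P)) v = 0 ->
  exists f : R -> E, (forall a, M (f a) /\ (a \in s -> T (f a) = a *: f a)) /\
    v = \sum_(a <- s) f a.
Proof.
move=> MD MZ MT; elim: s v => [|a s IHs] v /=.
  move=> _ Mv; rewrite big_nil pactC scale1r => v0; exists (fun=> v); split => //.
  by rewrite big_nil v0.
case/andP => as_ us Mv; rewrite big_cons mulrC pactM pactXsubC => hv.
have [|f [fM fE]] := IHs _ us _ hv; first by apply: MD; [exact: MT|rewrite -scaleNr; exact: MZ].
pose g b := (b - a)^-1 *: f b.
have gM : M (v - \sum_(b <- s) g b).
  apply: (MD _ _ Mv); rewrite -scaleN1r; apply: (MZ).
  apply: (big_ind M) => //; first by rewrite -(scale0r v); exact: MZ.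
  by move=> b _; exact/MZ/(fM b).1.
exists (fun b => if b == a then v - \sum_(b <- s) g b else g b); split.
  move=> b; split; first by case: ifP => // _; exact/MZ/(fM b).1.
  rewrite inE; case: eqVneq => [-> _|_ /= bs]; last first.
    by rewrite linearZ_LR (fM b).2// !scalerA mulrC.
  apply/eqP; rewrite -subr_eq0 linearB linear_sum/=.
  suff -> : T v - \sum_(i <- s) T (g i) - a *: (v - \sum_(i <- s) g i) =
            \sum_(i <- s) (f i + a *: g i - T (g i)).
    rewrite big_seq big1// => c cs.
    have ca : c - a != 0 by rewrite subr_eq0; exact: (memPn as_).
    have -> : T (g c) = (c - a)^-1 *: (c *: f c) by rewrite /g linearZ_LR /= (fM c).2.
    rewrite /g !scalerA -{1}[f c]scale1r -scalerDl -scalerBl.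
    by rewrite (_ : _ - _ = 0) ?scale0r//; field.
  rewrite !big_split/= -fE sumrN -scaler_sumr.
  by apply: jdot_ext => u; rewrite !jdotE; ring.
rewrite big_cons eqxx -[LHS](subrK (\sum_(i <- s) g i)); congr (_ + _).
by apply: eq_big_seq => c cs; rewrite (negPf (memPn as_ _ cs)).
Qed.

End SelfAdjoint.

(** * Idempotents and the spectral theorem *)

Section Idempotents.
Context {R : realType} {E : euclideanJordanType R}.
Implicit Types (x y z u v w c d : E) (a b : R).

(** [jmul3] at c, c, c says that T = L(c) satisfies T (2 T - 1) (T - 1) = 0, whence the Peirce
    eigenvalues 0, 1/2, 1. *)
Lemma idem_cubic c v : idem c ->
  c ∘ (c ∘ (c ∘ v)) = (3 / 2) *: (c ∘ (c ∘ v)) - (1 / 2) *: (c ∘ v).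
Proof.
move=> cc; have := jmul3 c c c v; rewrite !cc => h.
by apply: jdot_ext => w; move: (congr1 (jdot^~ w) h); rewrite !jdotE; lra.
Qed.

(* With [T = L(c)], [2 T^2 - T] and [4 T - 4 T^2] are the Peirce projections onto the
   eigenspaces of [T] for the eigenvalues 1 and 1/2. *)
Lemma idem_quadratic c v : idem c ->
  let p := 2 *: (c ∘ (c ∘ v)) - c ∘ v in let q := c ∘ v - c ∘ (c ∘ v) in
  '[c ∘ v, v] = '[p, p] + 8 * '[q, q] /\ '[c ∘ v, v] = '[c ∘ v, c ∘ v] + 4 * '[q, q].
Proof.
move=> cc /=; set u := c ∘ v; set t := c ∘ u.
have uu : '[u, u] = '[t, v] by rewrite /t jmul_selfadj.
have tu : '[t, u] = 3 / 2 * '[t, v] - 1 / 2 * '[u, v].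
  by rewrite {1}/u -jmul_selfadj {1}/t /u idem_cubic// !jdotE; ring.
have tt : '[t, t] = 3 / 2 * '[t, u] - 1 / 2 * '[u, u].
  have -> : '[t, t] = '[c ∘ t, u] by rewrite jmul_selfadj.
  by rewrite /t /u idem_cubic// !jdotE; ring.
rewrite !jdotE (jdotC u t); split; lra.
Qed.

Lemma idem_jdot_ge0 c v : idem c -> 0 <= '[c ∘ v, v].
Proof.
by move=> cc; rewrite (idem_quadratic v cc).1 addr_ge0 ?mulr_ge0 ?jdot_ge0.
Qed.

Lemma idem_jdot_eq0 c v : idem c -> '[c ∘ v, v] = 0 -> c ∘ v = 0.
Proof.
move=> cc cv0; have := (idem_quadratic v cc).2; rewrite cv0 => h; apply: jdot_eq0.
have := jdot_ge0 (c ∘ v); have := jdot_ge0 (c ∘ v - c ∘ (c ∘ v)); lra.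
Qed.

(** [idem_quadratic] gives |c v|^2 <= <c v, v>; Cauchy-Schwarz then allows cancelling |c v|. *)
Lemma idem_mul_le c v : idem c -> `|c ∘ v| <= `|v|.
Proof.
move=> cc; have [h|h] := eqVneq (c ∘ v) 0; first by rewrite h normr0.
rewrite -(@ler_pM2l _ `|c ∘ v|) ?normr_gt0//.
apply: le_trans (jdot_le _ _); apply: le_trans (ler_norm _).
rewrite -expr2 normE (idem_quadratic v cc).2.
by rewrite lerDl mulr_ge0 ?jdot_ge0.
Qed.

Lemma idem_dot_ge0 c d : idem c -> idem d -> 0 <= '[c, d].
Proof. by move=> cc dd; rewrite -{1}dd jdotC jdot_mul jdotC jmulC idem_jdot_ge0. Qed.

Lemma idem_orth c d : idem c -> idem d -> '[c, d] = 0 -> c ∘ d = 0.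
Proof.
move=> cc dd cd; apply: idem_jdot_eq0 => //.
by rewrite jdot_mul dd.
Qed.

Lemma orth_dot c d : idem c -> c ∘ d = 0 -> '[c, d] = 0.
Proof. by move=> cc cd; rewrite -cc jdot_mul cd jdot0r. Qed.

Lemma idem_compl c : idem c -> idem (junit - c).
Proof.
move=> cc; rewrite /Defs.idempotent !(jmulBl, jmulBr) jmul1x jmulx1 jmul1x cc.
by rewrite subrr subr0.
Qed.

Lemma idem_sum (I : finType) (P : pred I) (c : I -> E) :
  (forall i, P i -> idem (c i)) ->
  (forall i j, P i -> P j -> i != j -> c i ∘ c j = 0) ->
  idem (\sum_(i | P i) c i).
Proof.
move=> cc corth; rewrite /Defs.idempotent jmul_suml; apply: eq_bigr => i Pi.
rewrite jmul_sumr (bigD1 i)//= cc// big1 ?addr0// => j /andP[Pj ji].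
by apply: corth => //; rewrite eq_sym.
Qed.

Lemma idem_add c d : idem c -> idem d -> c ∘ d = 0 -> idem (c + d).
Proof.
move=> cc dd cd.
by rewrite /Defs.idempotent !(jmulDl, jmulDr) (jmulC d c) cd cc dd addr0 add0r.
Qed.

Lemma idem_unit_dot c : idem c -> '[c, junit] = '[c, c].
Proof. by move=> cc; rewrite -{1}cc jdot_mul jmulx1. Qed.

(** A Jordan frame with primitivity weakened to being nonzero; spectral decompositions are first
    obtained in this form and then refined. *)
Definition orth_system n (c : 'I_n -> E) : Prop :=
  [/\ forall i, idem (c i) /\ c i != 0,
      forall i j, i != j -> c i ∘ c j = 0 & \sum_i c i = junit].

Lemma frame_orth_system n (c : 'I_n -> E) : jordan_frame c -> orth_system c.
Proof. by case=> cp co cs; split=> // i; case: (cp i). Qed.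

(** Nonzero orthogonal idempotents are linearly independent. The bound makes refinement
    terminate. *)
Lemma orth_system_dim n (c : 'I_n -> E) : orth_system c -> (n <= dim E)%N.
Proof.
case=> cc co _; pose X := [tuple c i | i < n].
have XE (i : 'I_n) : X`_i = c i by rewrite -tnth_nth tnth_mktuple.
suff /eqP : free X by rewrite size_tuple => <-; rewrite -dimvf dimvS ?subvf.
apply/freeP => k kX i; have [ci ci0] := cc i.
have := congr1 (jdot (c i)) kX; rewrite jdot0r jdot_sumr (bigD1 i)//= big1 => [|j ji].
  by rewrite addr0 XE jdotZr => /eqP; rewrite mulf_eq0 (gt_eqF (jdot_gt0 ci0)) orbF => /eqP.
by rewrite XE jdotZr orth_dot ?mulr0//; apply: co; rewrite eq_sym.
Qed.

(** The unit, rather than [x], is decomposed into eigenvectors f a of L(x). As L(f a) commutes with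
    L(x), the product of f a and f b belongs to both eigenvalues a and b, so it vanishes when they
    differ. Multiplying the decomposition of the unit by f a shows f a idempotent; multiplying it by
    [x] expands [x]. *)
Lemma spectral_orth_system x : exists n (c : 'I_n -> E) (a : 'I_n -> R),
  orth_system c /\ x = \sum_i a i *: c i.
Proof.
(* [M] is stable under [L(x)]: by [jmul3], [L(x (x u))] is a polynomial in
   [L(x)], [L(x x)], [L(u)], [L(x u)]. *)
pose comm u w := forall z, u ∘ (w ∘ z) = w ∘ (u ∘ z).
pose N u := comm u x /\ comm u (x ∘ x).
pose M u := N u /\ N (x ∘ u).
have xx : comm x (x ∘ x) by move=> z; rewrite jordan_identity.
have commD u w z : comm u z -> comm w z -> comm (u + w) z.
  by move=> uz wz y; rewrite !jmulDl uz wz jmulDr.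
have commZ a u z : comm u z -> comm (a *: u) z.
  by move=> uz y; rewrite !jmulZl uz jmulZr.
have ND u w : N u -> N w -> N (u + w) by move=> [? ?] [? ?]; split; exact: commD.
have NZ a u : N u -> N (a *: u) by move=> [? ?]; split; exact: commZ.
have MD u w : M u -> M w -> M (u + w).
  by move=> [? ?] [? ?]; split; rewrite ?jmulDr; exact: ND.
have MZ a u : M u -> M (a *: u) by move=> [? ?]; split; rewrite ?jmulZr; exact: NZ.
have commN_mul u w : comm u x -> comm u (x ∘ x) -> comm (x ∘ u) x ->
  comm (x ∘ u) (x ∘ x) -> (w = x \/ w = x ∘ x) -> comm (x ∘ (x ∘ u)) w.
  move=> ux uxx xux xuxx ww z.
  have e y : (x ∘ (x ∘ u)) ∘ y = 2 *: ((x ∘ u) ∘ (x ∘ y)) + (x ∘ x) ∘ (u ∘ y)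
      - x ∘ (x ∘ (u ∘ y)) - u ∘ (x ∘ (x ∘ y)).
    have := jmul3 x u x y; rewrite (jmulC _ x) (jmulC u x) => ->.
    by apply: jdot_ext => t; rewrite !jdotE; ring.
  rewrite !e !(jmulDr, jmulNr, jmulZr).
  have xw y : x ∘ (w ∘ y) = w ∘ (x ∘ y) by case: ww => ->.
  have xxw y : (x ∘ x) ∘ (w ∘ y) = w ∘ ((x ∘ x) ∘ y) by case: ww => ->//.
  have uw y : u ∘ (w ∘ y) = w ∘ (u ∘ y) by case: ww => ->.
  have xuw y : (x ∘ u) ∘ (w ∘ y) = w ∘ ((x ∘ u) ∘ y) by case: ww => ->.
  by rewrite !(xw, xxw, uw, xuw).
have MT u : M u -> M (x ∘ u).
  by move=> [[ux uxx] [vx vxx]]; split => //; split; apply: commN_mul => //; [left|right].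
have Me : M junit.
  by split; split=> z; rewrite ?jmul1x ?jmulx1// ?jmul1x// xx.
pose T : {linear E -> E} := jmul x.
have Tsa u v : '[T u, v] = '[u, T v] by exact: jmul_selfadj.
have [s us se] := selfadj_real_annihilator Tsa junit.
have [f [fM fE]] := eigen_decomposition MD MZ MT us Me se.
have fx a : a \in s -> x ∘ f a = a *: f a by move=> /(fM a).2.
have f_orth a b : a \in s -> b \in s -> a != b -> f a ∘ f b = 0.
  move=> sa sb ab; have [[[fax _] _] _] := fM a.
  have [[[fbx _] _] _] := fM b.
  have h1 : b *: (f a ∘ f b) = x ∘ (f a ∘ f b) by rewrite -jmulZr -fx// fax.
  have h2 : a *: (f a ∘ f b) = x ∘ (f a ∘ f b).
    by rewrite (jmulC (f a)) -jmulZr -fx// fbx.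
  have /eqP : (b - a) *: (f a ∘ f b) = 0 by rewrite scalerBl h1 h2 subrr.
  by rewrite scaler_eq0 subr_eq0 eq_sym (negPf ab) => /eqP.
have f_idem a : a \in s -> idem (f a).
  move=> sa; have := jmulx1 (f a); rewrite fE jmul_sumr (bigD1_seq a)//= big1_seq ?addr0//.
  by move=> b /andP[ba sb]; apply: f_orth => //; rewrite eq_sym.
pose s' := [seq a <- s | f a != 0].
have s's (i : 'I_(size s')) : s'`_i \in s /\ f s'`_i != 0.
  by have := mem_nth 0 (ltn_ord i); rewrite mem_filter => /andP[].
have sumE (g : R -> E) : (forall a, f a = 0 -> g a = 0) ->
    \sum_(a <- s) g a = \sum_(i < size s') g s'`_i.
  move=> g0; rewrite -(big_mkord xpredT (fun i => g s'`_i)) -(big_nth 0 xpredT g).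
  rewrite big_filter [RHS]big_mkcond.
  by apply: eq_bigr => a _; case: eqVneq => // /g0.
exists (size s'), (fun i => f s'`_i), (fun i => s'`_i); split; first split.
- by move=> i; have [? ?] := s's i; split => //; exact: f_idem.
- move=> i j ij; have [? _] := s's i; have [? _] := s's j; apply: f_orth => //.
  by rewrite nth_uniq// filter_uniq.
- by rewrite -sumE// -fE.
rewrite -(sumE (fun a => a *: f a)) => [|a ->]; last by rewrite scaler0.
rewrite -[LHS]jmulx1 fE jmul_sumr; apply: eq_big_seq => a; exact: fx.
Qed.

(** A refinement with the largest number of nonzero members exists by [orth_system_dim]; a member
    that is not primitive could be split into a longer one. The map [p] records which [c i] each
    member refines; a zero [c i] has an empty fibre. *)
Lemma orth_idem_refine (I : finType) (c : I -> E) :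
  (forall i, idem (c i)) -> (forall i j, i != j -> c i ∘ c j = 0) -> \sum_i c i = junit ->
  exists m (f : 'I_m -> E) (p : 'I_m -> I),
    jordan_frame f /\ forall i, c i = \sum_(j | p j == i) f j.
Proof.
move=> ci c_orth ce.
pose P m := `[< exists (f : 'I_m -> E) (p : 'I_m -> I),
  orth_system f /\ forall i, c i = \sum_(j | p j == i) f j >].
have exP : exists m, P m.
  pose A := [pred i | c i != 0].
  exists #|A|; apply/asboolP; exists (c \o enum_val), enum_val; split; first split.
  - by move=> i; split; [exact: ci|have := enum_valP i; rewrite inE].
  - by move=> i j ij; apply: c_orth; rewrite (inj_eq enum_val_inj).
  - rewrite -ce -[LHS](@big_enum_val _ _ _ _ A c) [LHS]big_mkcond; apply: eq_bigr => i _.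
    by case: ifPn => //; rewrite inE negbK => /eqP.
  move=> i; rewrite -[RHS](@big_enum_val_cond _ _ _ _ A (pred1 i) c).
  have [ci0|ci0] := eqVneq (c i) 0.
    by rewrite big1// => j /andP[_ /eqP->].
  rewrite (bigD1 i) /= ?inE ?ci0 ?eqxx// big1 ?addr0// => j.
  by case/andP => /andP[_ /eqP->]; rewrite eqxx.
have bP m : P m -> (m <= dim E)%N.
  by move=> /asboolP[f [p [/orth_system_dim]]].
case: (ex_maxnP exP bP) => m /asboolP[f [p [fs fE]]] max_m.
exists m, f, p; split => //; have [fc fo fe] := fs; split => // i.
have [fi fi0] := fc i; split => // -[c1 [c2 [[c1c c10] [c2c c20] c12 fiE]]].
suff /max_m : P m.+1 by rewrite ltnn.
(* Both <c1, f j> and <c2, f j> are nonnegative and their sum <f i, f j> is 0. *)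
have co j : j != i -> c1 ∘ f j = 0 /\ c2 ∘ f j = 0.
  move=> ji; have [fj _] := fc j.
  have : '[f i, f j] = 0 by apply: orth_dot => //; apply: fo; rewrite eq_sym.
  rewrite fiE jdotDl => h; split; apply: idem_orth => //.
    by have := idem_dot_ge0 c1c fj; have := idem_dot_ge0 c2c fj; lra.
  by have := idem_dot_ge0 c1c fj; have := idem_dot_ge0 c2c fj; lra.
(* [c1] takes the place of [f i], and [c2] is inserted at position 0. *)
pose g (j : 'I_m.+1) : E := if unlift ord0 j is Some k then
  if k == i then c1 else f k else c2.
pose q (j : 'I_m.+1) : I := if unlift ord0 j is Some k then p k else p i.
apply/asboolP; exists g, q.
have g0 : g ord0 = c2 by rewrite /g unlift_none.
have gS k : g (lift ord0 k) = if k == i then c1 else f k by rewrite /g liftK.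
have q0 : q ord0 = p i by rewrite /q unlift_none.
have qS k : q (lift ord0 k) = p k by rewrite /q liftK.
have sumE (Q : pred I) : \sum_(j | Q (q j)) g j = \sum_(j | Q (p j)) f j.
  rewrite big_mkcond big_ord_recl g0 q0 [RHS]big_mkcond (bigD1 i)//= [RHS](bigD1 i)//= addrA.
  rewrite gS qS eqxx; congr (_ + _); first by case: ifP => _; rewrite ?addr0// fiE addrC.
  by apply: eq_bigr => k ki; rewrite gS qS (negPf ki).
split; last by move=> k; rewrite fE; exact: (esym (sumE (pred1 k))).
split.
- move=> j; case: (unliftP ord0 j) => [k ->|->]; rewrite ?g0// gS.
  by case: ifP => _ //.
- move=> j k; case: (unliftP ord0 j) => [j' ->|->]; case: (unliftP ord0 k) => [k' ->|->];
    rewrite ?gS ?g0 ?eqxx// => jk.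
  + have {}jk : j' != k' by apply: contraNneq jk => ->.
    case: eqVneq => [ji|ji]; case: eqVneq => [ki|ki].
    * by rewrite ji ki eqxx in jk.
    * exact: (co _ ki).1.
    * by rewrite jmulC (co _ ji).1.
    * exact: fo.
  + by case: eqVneq => [_//|/co[_]]; rewrite jmulC.
  + by case: eqVneq => [_|/co[_]//]; rewrite jmulC.
- by rewrite (sumE xpredT).
Qed.

Lemma spectral_theorem x : exists n (c : 'I_n -> E) (a : 'I_n -> R),
  jordan_frame c /\ x = \sum_i a i *: c i.
Proof.
have [n [c [a [cs ->]]]] := spectral_orth_system x.
have [cc co ce] := cs.
have [m [f [p [fs cE]]]] := orth_idem_refine (fun i => (cc i).1) co ce.
exists m, f, (a \o p); split => //; rewrite (partition_big p xpredT)//=.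
by apply: eq_bigr => i _; rewrite cE scaler_sumr; apply: eq_bigr => j /eqP <-.
Qed.

End Idempotents.

(** * Eigenvalues *)

(** Since the weights sum to [k], subtracting [t] from every a i does not change the right side,
    which becomes the sum of (a i - t) ([i < k] - w i). Every term is nonnegative, and those with i
    < m are at least g (1 - w i). *)
Lemma ky_fan_sum (R : realFieldType) (r k m : nat) (a : nat -> R) (w : 'I_r -> R) (t g : R) :
  (forall i, 0 <= w i <= 1) -> \sum_i w i = k%:R -> (k <= r)%N -> (m <= k)%N ->
  (forall i, (i < m)%N -> t + g <= a i) ->
  (forall i, (m <= i < k)%N -> t <= a i) ->
  (forall i, (k <= i < r)%N -> a i <= t) ->
  g * \sum_(i < r | (i < m)%N) (1 - w i) <=
    \sum_(i < r | (i < k)%N) a i - \sum_(i < r) a i * w i.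
Proof.
move=> w01 wk kr mk am ak ar.
have sk : \sum_(i < r | (i < k)%N) (1 : R) = k%:R.
  by rewrite -(big_ord_widen r (fun=> 1) kr) sumr_const card_ord.
have -> : \sum_(i < r | (i < k)%N) a i - \sum_(i < r) a i * w i =
    \sum_(i < r) (a i - t) * ((i < k)%N%:R - w i).
  transitivity (\sum_(i < r | (i < k)%N) a i - \sum_(i < r) a i * w i
    - t * (\sum_(i < r | (i < k)%N) 1 - \sum_i w i)).
    by rewrite sk wk subrr mulr0 subr0.
  rewrite [X in X - _ - _]big_mkcond [X in t * (X - _)]big_mkcond -!sumrB mulr_sumr -sumrB.
  by apply: eq_bigr => i _; case: ifP => _ /=; ring.
rewrite big_mkcond mulr_sumr; apply: ler_sum => i _.
have /andP[w0 w1] := w01 i.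
case: ltnP => im.
  rewrite (leq_trans im mk); have := am _ im => h.
  by rewrite ler_wpM2r ?subr_ge0//; lra.
rewrite mulr0; case: ltnP => ik.
  by rewrite mulr_ge0 ?subr_ge0// ak// im.
by rewrite sub0r mulrN -mulNr mulr_ge0// oppr_ge0 subr_le0 ar// ik ltn_ord.
Qed.

Section Eigenvalues.
Context {R : realType} {E : euclideanJordanType R}.
Hypothesis hdot : forall x y : E, jdot x y = jtr (jmul x y).
Implicit Types (x y z u v w : E).
Local Notation r := (jrank E).

Lemma orth_system_mul n (c : 'I_n -> E) (a : 'I_n -> R) i : orth_system c ->
  (\sum_j a j *: c j) ∘ c i = a i *: c i.
Proof.
case=> cc co _; rewrite jmul_suml (bigD1 i)//= jmulZl (cc i).1 big1 ?addr0// => j ji.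
by rewrite jmulZl co ?scaler0.
Qed.

Lemma has_spectrum_perm n (c : 'I_n -> E) (a : 'I_n -> R) (s : seq R) :
  jordan_frame c -> perm_eq s (codom a) -> has_spectrum (\sum_i a i *: c i) s.
Proof.
move=> [cp co ce] sa.
have ss : size s == n by rewrite (perm_size sa) size_codom card_ord.
pose t := Tuple ss; have /tuple_permP[p tE] : perm_eq t [tuple a i | i < n] by [].
have ta (i : 'I_(size s)) : s`_i = a (p (cast_ord (eqP ss) i)).
  transitivity (tnth t (cast_ord (eqP ss) i)); first by rewrite (tnth_nth 0).
  rewrite (_ : t = [tuple tnth [tuple a i | i < n] (p i) | i < n]); last exact: val_inj.
  by rewrite !tnth_mktuple.
pose f i := p (cast_ord (eqP ss) i).
have fb : bijective f.
  exists (fun j => cast_ord (esym (eqP ss)) ((p^-1)%g j)) => i /=.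
    by rewrite /f permK cast_ordK.
  by rewrite /f cast_ordKV permKV.
exists (c \o f); split.
- split => /=; first by [].
  + by move=> i j ij; apply: co; rewrite (bij_eq fb).
  + by rewrite -ce [RHS](reindex f)//; exact: onW_bij.
- rewrite [LHS](reindex f) /=; last exact: onW_bij.
  by apply: eq_bigr => i _; rewrite ta.
Qed.

Lemma eigvalsP x : sorted >=%R (eigvals x) /\ has_spectrum x (eigvals x).
Proof.
suff : [set a | sorted >=%R a /\ has_spectrum x a] (eigvals x) by [].
apply: xgetPex; have [n [c [a [cf ->]]]] := spectral_theorem x.
exists (sort >=%R (codom a)); split; first by apply: sort_sorted => ? ?; exact: ge_total.
by apply: has_spectrum_perm => //; rewrite perm_sort.
Qed.

(** This is where the normalization [hdot] enters: the left side is the sum of the eigenvalues of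
    [c]. Idempotency forces them to be 0 or 1; no 1 would give c = 0, and two would split [c]. *)
Lemma primitive_dot (c : E) : primitive_idempotent c -> '[c, c] = 1.
Proof.
move=> [cc c0 cp]; rewrite hdot cc /jtr.
have [_ [f [ff cE]]] := eigvalsP c; set s := eigvals c in f ff cE *.
have fs := frame_orth_system ff; have [fc fo _] := fs.
have s01 (i : 'I_(size s)) : s`_i = 0 \/ s`_i = 1.
  have h : c ∘ f i = s`_i *: f i by rewrite {1}cE (orth_system_mul _ _ fs).
  have h2 : '[c, c ∘ f i] = '[c, f i] by rewrite -jdot_mul cc.
  have cf : '[c, f i] = s`_i * '[f i, f i].
    by rewrite -{1}(fc i).1 -jdot_mul h jdotZl.
  have fi := jdot_gt0 (fc i).2.
  move: h2; rewrite h jdotZr cf => /eqP.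
  rewrite -subr_eq0 -{2}[_ * '[_, _]]mul1r -mulrBl !mulf_eq0 (gt_eqF fi) orbF subr_eq0.
  by case/orP => /eqP; [right|left].
have [i0 si0] : exists i : 'I_(size s), s`_i = 1.
  apply: contrapT => h; move: c0; rewrite cE big1 ?eqxx// => i _.
  by have [->|si] := s01 i; rewrite ?scale0r//; case: h; exists i.
pose P (i : 'I_(size s)) := (s`_i == 1) && (i != i0).
have cE2 : c = f i0 + \sum_(i < size s | P i) f i.
  rewrite {1}cE (bigD1 i0)//= si0 scale1r; congr (_ + _).
  rewrite big_mkcond [RHS]big_mkcond; apply: eq_bigr => i _; rewrite /P.
  case: (eqVneq i i0) => [_|_] /=; first by rewrite andbF.
  rewrite andbT.
  by have [->|->] := s01 i; rewrite ?eqxx ?scale1r// eq_sym oner_eq0 scale0r.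
have fP0 : \sum_(i < size s | P i) f i = 0.
  apply: contrapT => /eqP fP0; case: cp; exists (f i0), (\sum_(i < size s | P i) f i).
  split => //; first split => //.
    by apply: idem_sum => [i _|i j _ _]; [exact: (fc i).1|exact: fo].
  by rewrite jmul_sumr big1// => i /andP[_ ii0]; rewrite fo// eq_sym.
have {}fP0 i : ~~ P i.
  apply/negP => Pi; have /eqP := congr1 (jdot (f i)) fP0.
  rewrite jdot0r jdot_sumr (bigD1 i)//= big1 ?addr0 ?(gt_eqF (jdot_gt0 (fc i).2))//.
  by move=> j /andP[_ ji]; apply: (orth_dot (fc i).1); rewrite fo// eq_sym.
rewrite (big_nth 0) big_mkord (bigD1 i0)//= si0 big1 ?addr0// => i ii0.
have [//|si] := s01 i; have := fP0 i; by rewrite /P si eqxx ii0.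
Qed.

Lemma primitive_trace (c : E) : primitive_idempotent c -> '[c, junit] = 1.
Proof. by move=> cp; rewrite idem_unit_dot ?primitive_dot//; case: cp. Qed.

(** Each member has trace 1, so the length of a frame depends on [E] alone. *)
Lemma frame_size n (c : 'I_n -> E) : jordan_frame c -> n%:R = '[junit, junit : E].
Proof.
move=> [cp _ ce]; rewrite -{1}ce jdot_suml.
by under eq_bigr do rewrite primitive_trace//; rewrite sumr_const card_ord.
Qed.

Lemma frame_jrank n (c : 'I_n -> E) : jordan_frame c -> n = r.
Proof.
move=> cf; have : [set n | exists c : 'I_n -> E, jordan_frame c] r.
  by apply: xgetPex; exists n, c.
by move=> [f ff]; apply/eqP; rewrite -(eqr_nat R) (frame_size cf) (frame_size ff).
Qed.

Lemma size_eigvals x : size (eigvals x) = r.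
Proof. by have [_ [c [/frame_jrank]]] := eigvalsP x. Qed.

(** Positions in [a] start at 0 whereas [lambda] counts from 1, hence [lambda i.+1] below. *)
Definition sorted_frame x (c : 'I_r -> E) (a : nat -> R) : Prop :=
  [/\ jordan_frame c, x = \sum_(i < r) a i *: c i &
      forall i j, (i <= j < r)%N -> a j <= a i].

Lemma has_spectrum_frame x s : sorted >=%R s -> has_spectrum x s ->
  exists c, sorted_frame x c (nth 0 s).
Proof.
move=> ss [c [cf xE]]; have sr := frame_jrank cf.
have [c' [cf' xE' sr']] : exists c : 'I_r -> E,
    [/\ jordan_frame c, x = \sum_(i < r) s`_i *: c i & size s = r].
  by rewrite -sr; exists c.
exists c'; split => // i j /andP[ij jr].
apply: (sorted_leq_nth (leT := >=%R) _ _ 0 ss) => //; rewrite ?inE ?sr'//.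
- by move=> y x0 z /= h1 h2; exact: le_trans h2 h1.
- by move=> y; exact: lexx.
- exact: leq_ltn_trans ij jr.
Qed.

Lemma eigen_frame x : exists c, sorted_frame x c (fun i => lambda i.+1 x).
Proof. by have [] := eigvalsP x; exact: has_spectrum_frame. Qed.

Lemma frame_coef (c : 'I_r -> E) (a : 'I_r -> R) i : jordan_frame c ->
  '[\sum_j a j *: c j, c i] = a i.
Proof.
move=> cf; have [cp _ _] := cf; have [ci _ _] := cp i.
rewrite -{1}ci -jdot_mul (orth_system_mul _ _ (frame_orth_system cf)) jdotZl.
by rewrite primitive_dot ?mulr1.
Qed.

Lemma frame_dot_sum (c : 'I_r -> E) (P : pred 'I_r) : jordan_frame c ->
  '[\sum_(i | P i) c i, junit] = (\sum_(i | P i) 1%N)%:R.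
Proof.
move=> [cp _ _]; rewrite jdot_suml natr_sum; apply: eq_bigr => i _.
by rewrite primitive_trace.
Qed.

Lemma frame_idem_sum (c : 'I_r -> E) (P : pred 'I_r) : jordan_frame c ->
  idem (\sum_(i | P i) c i).
Proof.
by move=> [cp co _]; apply: idem_sum => [i _|i j _ _]; [case: (cp i)|exact: co].
Qed.

Lemma frame_weight (c : 'I_r -> E) v i : jordan_frame c -> idem v ->
  0 <= '[c i, v] <= 1.
Proof.
move=> [cp _ _] vv; have [ci _ _] := cp i; rewrite idem_dot_ge0//=.
have := idem_dot_ge0 ci (idem_compl vv).
by rewrite jdotBr primitive_trace ?subr_ge0.
Qed.

Lemma frame_weight_sum (c : 'I_r -> E) v : jordan_frame c ->
  \sum_i '[c i, v] = '[v, junit].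
Proof. by move=> [_ _ ce]; rewrite -jdot_suml ce jdotC. Qed.

(** For a sorted frame of [x], the idempotent of trace [k] attaining Ky Fan's maximum. *)
Definition topsum (c : 'I_r -> E) k : E := \sum_(i < r | (i < k)%N) c i.

Lemma sum_ord_lt k : (k <= r)%N -> (\sum_(i < r | (i < k)%N) 1 = k)%N.
Proof. by move=> kr; rewrite -(big_ord_widen r (fun=> 1%N) kr) sum1_card card_ord. Qed.

Lemma topsum_trace c k : jordan_frame c -> (k <= r)%N -> '[topsum c k, junit] = k%:R.
Proof. by move=> cf kr; rewrite frame_dot_sum// sum_ord_lt. Qed.

Lemma sorted_frame_dot_top x c a k : sorted_frame x c a ->
  '[x, topsum c k] = \sum_(i < r | (i < k)%N) a i.
Proof.
move=> [cf -> _]; rewrite jdot_sumr; apply: eq_bigr => i _.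
by rewrite (frame_coef (fun i => a i)).
Qed.

(* The gap version of Ky Fan's inequality: [v] is compared with the sum of the [k]
   largest eigenvalues, and the defect controls the part of [topsum c m] outside [v]. *)
Lemma ky_fan_gap x c a k m t g v : sorted_frame x c a -> idem v ->
  '[v, junit] = k%:R -> (k <= r)%N -> (m <= k)%N ->
  (forall i, (i < m)%N -> t + g <= a i) ->
  (forall i, (m <= i < k)%N -> t <= a i) ->
  (forall i, (k <= i < r)%N -> a i <= t) ->
  g * (m%:R - '[topsum c m, v]) <= \sum_(i < r | (i < k)%N) a i - '[x, v].
Proof.
move=> [cf xE a_dec] vv vk kr mk h1 h2 h3.
have := ky_fan_sum (fun i => frame_weight i cf vv)
  (etrans (frame_weight_sum v cf) vk) kr mk h1 h2 h3.
have -> : \sum_(i < r) a i * '[c i, v] = '[x, v].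
  by rewrite xE jdot_suml; apply: eq_bigr => i _; rewrite jdotZl.
rewrite sumrB -jdot_suml -/(topsum c m).
have -> // : \sum_(i < r | (i < m)%N) (1 : R) = m%:R.
by rewrite -(big_ord_widen r (fun=> 1) (leq_trans mk kr)) sumr_const card_ord.
Qed.

Lemma ky_fan x c a k v : sorted_frame x c a -> idem v ->
  '[v, junit] = k%:R -> (k <= r)%N -> '[x, v] <= \sum_(i < r | (i < k)%N) a i.
Proof.
move=> xc vv vk kr; have [_ _ a_dec] := xc.
(* No gap is claimed (m = 0, g = 0); the threshold is the smallest of the [k] largest eigenvalues,
   or the largest eigenvalue when k = 0. *)
have := @ky_fan_gap x c a k 0 (if k == 0%N then a 0%N else a k.-1) 0 v xc vv vk kr (leq0n _).
rewrite mul0r subr_ge0; apply => //.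
  move=> i /=; case: k {vk} kr => // k kr; rewrite ltnS /= => ik.
  by apply: a_dec; rewrite ik.
move=> i; case: k {vk} kr => [_|k kr] /andP[ki ir]; apply: a_dec; rewrite ?ir ?andbT//.
exact: ltnW.
Qed.

(** By [ky_fan], each partial sum is a maximum that does not depend on the frame; consecutive
    differences then agree. *)
Lemma sorted_frame_uniq x c a d b : sorted_frame x c a -> sorted_frame x d b ->
  forall i, (i < r)%N -> a i = b i.
Proof.
move=> xa xb.
have le_sum c1 a1 c2 a2 k : sorted_frame x c1 a1 -> sorted_frame x c2 a2 -> (k <= r)%N ->
    \sum_(i < r | (i < k)%N) a1 i <= \sum_(i < r | (i < k)%N) a2 i.
  move=> x1 x2 kr; rewrite -(sorted_frame_dot_top _ x1); have [cf _ _] := x1.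
  by apply: (ky_fan x2) => //; [exact: frame_idem_sum|exact: topsum_trace].
have eq_sum k : (k <= r)%N -> \sum_(i < k) a i = \sum_(i < k) b i.
  move=> kr; rewrite (big_ord_widen r a kr) (big_ord_widen r b kr).
  by apply/eqP; rewrite eq_le (le_sum _ _ _ _ _ xa xb)// (le_sum _ _ _ _ _ xb xa).
move=> i ir; have := eq_sum _ ir; rewrite !big_ord_recr /= eq_sum 1?ltnW//.
exact: addrI.
Qed.

Lemma sorted_frame_lambda x c a i : sorted_frame x c a -> (i < r)%N -> a i = lambda i.+1 x.
Proof. by have [d xd] := eigen_frame x; move=> xc; exact: sorted_frame_uniq xc xd _. Qed.

Lemma eigvals_perm (c : 'I_r -> E) (a : 'I_r -> R) : jordan_frame c ->
  perm_eq (eigvals (\sum_i a i *: c i)) (codom a).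
Proof.
move=> cf; set x := \sum_i _; set s := sort >=%R (codom a).
have sa : perm_eq s (codom a) by rewrite perm_sort.
have [|d xd] := has_spectrum_frame _ (has_spectrum_perm cf sa).
  by apply: sort_sorted => ? ?; exact: ge_total.
suff -> : eigvals x = s by [].
have ss : size s = r by rewrite (perm_size sa) size_codom card_ord.
apply: (@eq_from_nth _ 0); rewrite size_eigvals ?ss// => i ir.
by rewrite (sorted_frame_lambda xd).
Qed.

End Eigenvalues.

(** Lets [lambda k] be read off an unsorted frame expansion by counting. *)
Lemma nth_sorted_count (R : realDomainType) (s : seq R) (k : nat) (t : R) :
  sorted >=%R s ->
  (count (fun a => (t < a)%R) s <= k < count (fun a => (t <= a)%R) s)%N -> s`_k = t.
Proof.
move=> ss /andP[lt_k k_lt].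
have ks : (k < size s)%N by exact: leq_trans k_lt (count_size _ _).
have dec i j : (i <= j)%N -> (j < size s)%N -> s`_j <= s`_i.
  move=> ij js; apply: (sorted_leq_nth (leT := >=%R) _ _ 0 ss) => //.
  - by move=> y x z /= h1 h2; exact: le_trans h2 h1.
  - by move=> y; exact: lexx.
  - exact: leq_ltn_trans ij js.
apply/eqP; rewrite eq_le; apply/andP; split; rewrite leNgt; apply/negP => h.
  move: lt_k; rewrite leqNgt => /negP; apply.
  rewrite -(cat_take_drop k.+1 s) count_cat; apply: leq_trans (leq_addr _ _).
  suff : all (fun a => t < a) (take k.+1 s).
    by rewrite all_count => /eqP ->; rewrite size_takel.
  apply/(all_nthP (0 : R)) => i; rewrite size_takel// ltnS => ik.
  by rewrite nth_take//; apply: lt_le_trans h _; exact: dec.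
move: k_lt; rewrite ltnNge => /negP; apply.
rewrite -(cat_take_drop k s) count_cat.
suff /eqP -> : count (fun a => t <= a) (drop k s) == 0%N.
  rewrite addn0; apply: leq_trans (count_size _ _) _; rewrite size_takel// ltnW//.
rewrite -leqn0 leqNgt -has_count; apply/negP => /hasP[b bs]; apply/negP.
rewrite -ltNge; apply: le_lt_trans h.
have [j] := elimT (nthP 0) bs; rewrite size_drop nth_drop => jk <-.
by apply: dec; rewrite ?leq_addr// -ltn_subRL.
Qed.

Lemma convex_setP (R : numDomainType) (V : lmodType R) (A : set V) :
  @convex_set R V A <-> (forall x y t, A x -> A y -> 0 <= t -> t <= 1 ->
    A (t *: x + (1 - t) *: y)).
Proof.
split => [cA x y t Ax Ay t0 t1|cA x y t]; last first.
  by rewrite !inE => Ax Ay; exact: cA.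
by have := cA x y (Itv01 t0 t1) (mem_set Ax) (mem_set Ay); rewrite inE.
Qed.

(** Dividing by the total weight lets the induction pass to the tail. Points of weight 0 may lie
    outside [A], as will happen for frame members off the support. *)
Lemma convex_combination (R : numFieldType) (V : lmodType R) (A : set V)
    (I : eqType) (s : seq I) (b : I -> R) (f : I -> V) :
  @convex_set R V A -> (forall i, 0 <= b i) -> (forall i, b i != 0 -> A (f i)) ->
  0 < \sum_(i <- s) b i ->
  A ((\sum_(i <- s) b i)^-1 *: \sum_(i <- s) b i *: f i).
Proof.
move=> /convex_setP cA b0 Af; elim: s => [|i s IHs]; rewrite ?big_nil ?ltxx// !big_cons.
have : 0 <= \sum_(j <- s) b j by exact: sumr_ge0.
rewrite le_eqVlt => /predU1P[/esym s0|s0].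
  have -> : \sum_(j <- s) b j *: f j = 0.
    move/eqP: s0; rewrite psumr_eq0// => /all_filterP <-; rewrite big_filter.
    by rewrite big1// => j /eqP ->; rewrite scale0r.
  rewrite s0 !addr0 => bi.
  by rewrite scalerA mulVf ?gt_eqF// scale1r; apply: Af; rewrite gt_eqF.
move=> bs; have [bi|bi] := eqVneq (b i) 0.
  by rewrite bi scale0r !add0r; exact: IHs.
have := cA _ _ (b i / (b i + \sum_(j <- s) b j)) (Af i bi) (IHs s0).
set S := \sum_(j <- s) b j in s0 bs *; rewrite ler_pdivrMr// mul1r lerDl.
rewrite divr_ge0 ?(ltW bs)// (ltW s0) => /(_ isT isT).
rewrite scalerA scalerDr scalerA (mulrC (b i)).
rewrite (_ : (1 - _) * S^-1 = (b i + S)^-1)//.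
by field; rewrite !gt_eqF.
Qed.

(** * Ky Fan sums, Lipschitz bounds and the eigen-face *)

Section EigenvalueFunctions.
Context {R : realType} {E : euclideanJordanType R}.
Hypothesis hdot : forall x y : E, jdot x y = jtr (jmul x y).
Implicit Types (x y z u v w s : E).
Local Notation r := (jrank E).

Lemma count_codom n (a : 'I_n -> R) (P : pred R) :
  count P (codom a) = #|[pred i | P (a i)]|.
Proof. by rewrite count_map cardE size_filter enumT. Qed.

Lemma lambda_count (c : 'I_r -> E) (a : 'I_r -> R) k t : jordan_frame c ->
  (#|[pred i | (t < a i)%R]| < k <= #|[pred i | (t <= a i)%R]|)%N ->
  lambda k (\sum_i a i *: c i) = t.
Proof.
move=> cf /andP[h1 h2]; have [ss _] := eigvalsP (\sum_i a i *: c i).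
have sp := eigvals_perm hdot a cf.
case: k h1 h2 => // k h1 h2; apply: nth_sorted_count => //.
by rewrite !(seq.permP sp) !count_codom -ltnS h1.
Qed.

Lemma elt_rank_frame (c : 'I_r -> E) (a : 'I_r -> R) : jordan_frame c ->
  elt_rank (\sum_i a i *: c i) = #|[pred i | a i != 0]|.
Proof. by move=> cf; rewrite /elt_rank (seq.permP (eigvals_perm hdot a cf)) count_codom. Qed.

Lemma lambda_antitone x i j : (i <= j < r)%N -> lambda j.+1 x <= lambda i.+1 x.
Proof. by have [c [_ _]] := eigen_frame hdot x; apply. Qed.

Definition sigma k x : R := \sum_(i < r | (i < k)%N) lambda i.+1 x.

Lemma sigmaS k x : (k < r)%N -> sigma k.+1 x = sigma k x + lambda k.+1 x.
Proof.
move=> kr; rewrite /sigma -!(big_ord_widen r (fun i => lambda i.+1 x))//; last exact: ltnW.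
by rewrite big_ord_recr.
Qed.

Lemma idem_norm v k : idem v -> '[v, junit] = k%:R -> `|v| <= k%:R.
Proof.
move=> vv vk; rewrite -(@ler_pXn2r _ 2) ?nnegrE// normE -idem_unit_dot// vk.
rewrite -natrX ler_nat -mulnn; case: k {vk} => // k; rewrite leq_pmulr//.
Qed.

Lemma sigma_max k x : (k <= r)%N -> exists u, [/\ idem u, '[u, junit] = k%:R & sigma k x = '[x, u]].
Proof.
move=> kr; have [c xc] := eigen_frame hdot x; have [cf _ _] := xc.
exists (topsum c k); rewrite (sorted_frame_dot_top hdot k xc); split => //.
  exact: frame_idem_sum.
exact: topsum_trace.
Qed.

Lemma sigma_ge k x v : (k <= r)%N -> idem v -> '[v, junit] = k%:R -> '[x, v] <= sigma k x.
Proof. by move=> kr vv vk; have [c xc] := eigen_frame hdot x; exact: ky_fan xc _ _ _. Qed.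

(** A maximizer at one point competes at the other, and its norm is at most k <= r. The constant is
    crude. *)
Lemma sigma_lipschitz k x y : (k <= r)%N -> `|sigma k x - sigma k y| <= r%:R * `|x - y|.
Proof.
move=> kr; suff h z w : sigma k z - sigma k w <= r%:R * `|z - w|.
  by rewrite ler_norml h lerNl opprB distrC h.
have [u [uu uk ->]] := sigma_max z kr; have := sigma_ge w kr uu uk => h.
apply: le_trans (_ : '[z - w, u] <= _); first by rewrite jdotBl lerD2l lerN2.
apply: le_trans (ler_norm _) _; apply: le_trans (jdot_le _ _) _.
rewrite mulrC ler_wpM2r//; apply: le_trans (idem_norm uu uk) _.
by rewrite ler_nat.
Qed.

Lemma lambda_lipschitz k x y : (1 <= k <= r)%N ->
  `|lambda k x - lambda k y| <= 2 * r%:R * `|x - y|.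
Proof.
case: k => // k /= kr.
have e z : lambda k.+1 z = sigma k.+1 z - sigma k z by rewrite sigmaS// addrC addKr.
have h1 := sigma_lipschitz x y kr; have h2 := sigma_lipschitz x y (ltnW kr).
rewrite !e; apply: le_trans (_ : `|sigma k.+1 x - sigma k.+1 y| + `|sigma k x - sigma k y| <= _).
  rewrite (_ : _ - _ - _ = (sigma k.+1 x - sigma k.+1 y) - (sigma k x - sigma k y)); last ring.
  exact: ler_normB.
by lra.
Qed.

(** In a frame of [x], each coefficient is at most |x| in absolute value and multiplication by an
    idempotent is a contraction. *)
Lemma jmul_le x y : `|x ∘ y| <= r%:R * `|x| * `|y|.
Proof.
have [c [cf xE _]] := eigen_frame hdot x; have [cp _ _] := cf.
rewrite {1}xE jmul_suml; apply: le_trans (ler_norm_sum _ _ _) _.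
rewrite -mulrA mulr_natl -{6}(card_ord r) -sumr_const; apply: ler_sum => i _.
have [ci _ _] := cp i.
rewrite jmulZl normrZ ler_pM// ?idem_mul_le//.
rewrite -(frame_coef hdot (fun i => lambda i.+1 x) i cf) -xE.
apply: le_trans (jdot_le _ _) _; rewrite -[leRHS]mulr1 ler_wpM2l//.
by apply: (@idem_norm _ 1) => //; rewrite primitive_trace.
Qed.

(** Equivalently, all eigenvalues are nonnegative; testing on idempotents makes the condition
    visibly convex and closed. *)
Definition psd s : Prop := forall d, idem d -> 0 <= '[s, d].

Lemma psd_coef s (c : 'I_r -> E) (b : 'I_r -> R) i : jordan_frame c ->
  s = \sum_j b j *: c j -> psd s -> 0 <= b i.
Proof.
move=> cf sE ps; rewrite -(frame_coef hdot b i cf) -sE; apply: ps.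
by have [cp _ _] := cf; case: (cp i).
Qed.

(** <s, d> is a sum of nonnegative terms b j <c j, d>, so each of them vanishes. *)
Lemma psd_orth s (c : 'I_r -> E) (b : 'I_r -> R) d i : jordan_frame c ->
  s = \sum_j b j *: c j -> psd s -> idem d -> '[s, d] = 0 -> b i != 0 -> c i ∘ d = 0.
Proof.
move=> cf sE ps dd sd bi; have [cp _ _] := cf; have [ci _ _] := cp i.
have cd j : 0 <= b j * '[c j, d].
  rewrite mulr_ge0// ?(psd_coef _ cf sE ps)//.
  by apply: idem_dot_ge0 => //; case: (cp j).
move: sd; rewrite sE jdot_suml; under eq_bigr do rewrite jdotZl.
move=> /eqP; rewrite psumr_eq0// => /allP/(_ i (mem_index_enum i)) /=.
by rewrite mulf_eq0 (negPf bi) => /eqP; exact: idem_orth.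
Qed.

(** The set C(x) of the overview. *)
Definition eigen_face k x : set E :=
  [set s | [/\ psd s, '[s, junit] = 1 & x ∘ s = lambda k x *: s]].

(** [c i] and [s] belong to different eigenvalues of the self-adjoint L(x). *)
Lemma eigen_coef_orth x (c : 'I_r -> E) (a : 'I_r -> R) s t i : jordan_frame c ->
  x = \sum_j a j *: c j -> x ∘ s = t *: s -> a i != t -> '[s, c i] = 0.
Proof.
move=> cf xE xs ait.
have h : a i * '[c i, s] = t * '[c i, s].
  rewrite -jdotZl -(orth_system_mul a i (frame_orth_system cf)) -xE jmul_selfadj xs.
  by rewrite jdotZr.
move/eqP: h; rewrite -subr_eq0 -mulrBl mulf_eq0 subr_eq0 (negPf ait) /=.
by rewrite jdotC => /eqP.
Qed.

Lemma eigen_orth x (c : 'I_r -> E) (a : 'I_r -> R) s t : jordan_frame c ->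
  x = \sum_j a j *: c j -> (forall i, a i != t -> c i ∘ s = 0) -> x ∘ s = t *: s.
Proof.
move=> cf -> h; have [_ _ ce] := cf.
rewrite -{2}(jmul1x s) -ce !jmul_suml scaler_sumr; apply: eq_bigr => i _.
by rewrite jmulZl; have [->//|/h ->] := eqVneq (a i) t; rewrite !scaler0.
Qed.

(** Frame members of [x] with another eigenvalue are orthogonal to [s], hence, [s] being positive,
    to every [c i] in its support. *)
Lemma eigen_face_coef k x s (c : 'I_r -> E) (b : 'I_r -> R) i : eigen_face k x s ->
  jordan_frame c -> s = \sum_j b j *: c j -> b i != 0 -> x ∘ c i = lambda k x *: c i.
Proof.
move=> [ps _ xs] cf sE bi; have [d [df xE _]] := eigen_frame hdot x.
apply: (eigen_orth df xE) => j ajt; have [dp _ _] := df; have [dj _ _] := dp j.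
rewrite jmulC; apply: (psd_orth cf sE ps dj _ bi).
exact: (eigen_coef_orth df xE xs ajt).
Qed.

(** For the harder inclusion, the eigenvalues of [s] are nonnegative with sum 1, and
    [eigen_face_coef] puts the frame members of its support among the generators. *)
Lemma eigen_face_conv k x :
  convex_hull [set c | primitive_idempotent c /\ x ∘ c = lambda k x *: c] = eigen_face k x.
Proof.
apply/seteqP; split.
  apply: smallest_sub.
    apply/convex_setP => s w t [ps s1 xs] [pw w1 xw] t0 t1; split.
    - move=> d dd; rewrite jdotDl !jdotZl.
      by rewrite addr_ge0// mulr_ge0// ?subr_ge0//; [exact: ps|exact: pw].
    - by rewrite jdotDl !jdotZl s1 w1; ring.
    - by rewrite jmulDr !jmulZr xs xw scalerDr !scalerA !(mulrC (lambda k x)).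
  move=> c [cp xc]; have [cc _ _] := cp; split => //.
  - by move=> d dd; exact: idem_dot_ge0.
  - exact: primitive_trace.
move=> s fs; have [ps s1 xs] := fs.
have [c [cf sE _]] := eigen_frame hdot s; set b := fun i : 'I_r => lambda i.+1 s.
have b0 i : 0 <= b i by exact: psd_coef cf sE ps.
have b1 : \sum_i b i = 1.
  rewrite -s1 sE jdot_suml; apply: eq_bigr => i _.
  by have [cp _ _] := cf; rewrite jdotZl primitive_trace ?mulr1.
move=> A [cA GA]; have := @convex_combination _ _ A _ (index_enum 'I_r) b c cA b0.
rewrite b1 invr1 scale1r -sE => h; apply: h; last exact: ltr01.
move=> i bi; apply: GA; have [cp _ _] := cf; split => //.
exact: eigen_face_coef fs cf sE bi.
Qed.

(** Double counting: the rank is the sum of <d j, c i> over the support of [s] and all i. The inner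
    sum is at most 1, and is 0 when a i differs from [lambda k x]. *)
Lemma eigen_face_rank k x s (c : 'I_r -> E) (a : 'I_r -> R) : eigen_face k x s ->
  jordan_frame c -> x = \sum_j a j *: c j ->
  (elt_rank s <= #|[pred i | a i == lambda k x]|)%N.
Proof.
move=> fs cf xE; have [ps s1 xs] := fs.
have [d [df sE _]] := eigen_frame hdot s; set b := fun i : 'I_r => lambda i.+1 s in sE.
rewrite {1}sE elt_rank_frame// -(ler_nat R).
have -> : #|[pred i | b i != 0]|%:R = \sum_(j | b j != 0) '[d j, junit].
  rewrite -jdot_suml frame_dot_sum// sum1_card; congr (_%:R).
have [cp _ ce] := cf; have [dp _ de] := df.
under eq_bigr do rewrite -ce jdot_sumr.
rewrite exchange_big /= -sum1_card natr_sum [leRHS]big_mkcond /=; apply: ler_sum => i _.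
have [ci _ _] := cp i; rewrite inE; case: (eqVneq (a i) (lambda k x)) => ai.
  rewrite -jdot_suml -(primitive_trace hdot (cp i)) (jdotC (c i)) -de !jdot_suml.
  rewrite big_mkcond; apply: ler_sum => j _; have [dj _ _] := dp j.
  by case: ifP => // _; exact: idem_dot_ge0.
rewrite big1// => j bj; have [dj _ _] := dp j; apply: orth_dot => //.
apply: (psd_orth df sE ps ci _ bj).
exact: (eigen_coef_orth cf xE xs ai).
Qed.

End EigenvalueFunctions.

(** * Regular subdifferential *)

Section RegularSubdifferential.
Context {R : realType} {E : euclideanJordanType R}.
Implicit Types (g : E -> R) (x s d z : E).

Lemma regular_subdiffP g x s : regular_subdiff g x s <->
  forall e, 0 < e -> exists2 dl, 0 < dl &
    forall z, `|z| < dl -> g x + '[s, z] - e * `|z| <= g (x + z).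
Proof.
pose q z := ((g (x + z) - g x - '[s, z]) / `|z|)%:E.
rewrite /regular_subdiff /= limf_einfE -/q; split => [s0 e e0|h].
  have : ((- e)%:E < ereal_sup [set ereal_inf (q @` V) | V in (0%R : E)^'])%E.
    by apply: lt_le_trans s0; rewrite lte_fin oppr_lt0.
  move=> /ereal_sup_gt[_ [V V0 <-]] eV.
  have /nbhs_ballP[dl /= dl0 dlV] : nbhs (0 : E) (fun z => z != 0 -> V z) by [].
  exists dl => // z zdl; have [->|z0] := eqVneq z 0.
    by rewrite jdot0r normr0 !addr0 mulr0 subr0.
  have Vz : V z by apply: dlV => //; rewrite -ball_normE /= sub0r normrN.
  have : ((- e)%:E < q z)%E by apply: lt_le_trans eV _; apply: ereal_inf_lbound; exists z.
  rewrite /q lte_fin ltr_pdivlMr ?normr_gt0// => hz; lra.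
apply/lee_subgt0Pr => e e0; rewrite sub0e.
have [dl dl0 hd] := h _ e0.
apply: le_ereal_sup_tmp; exists (ereal_inf (q @` [set z | z != 0 /\ `|z| < dl])).
  exists [set z | z != 0 /\ `|z| < dl] => //.
  apply/nbhs_ballP; exists dl => //= z; rewrite -ball_normE /= sub0r normrN => zdl z0.
  by split.
apply: le_ereal_inf_tmp => _ [z [z0 zdl] <-]; rewrite /q lee_fin.
by rewrite ler_pdivlMr ?normr_gt0//; have := hd _ zdl; lra.
Qed.

Lemma regular_subdiff_quadratic g x s C : 0 <= C ->
  (forall z, g x + '[s, z] - C * `|z| ^+ 2 <= g (x + z)) -> regular_subdiff g x s.
Proof.
move=> C0 h; apply/regular_subdiffP => e e0.
have C1 : 0 < C + 1 by lra.
exists (e / (C + 1)); first exact: divr_gt0.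
move=> z zd; apply: le_trans (h z); rewrite lerD2l lerN2 expr2 mulrA ler_wpM2r//.
move: zd; rewrite ltr_pdivlMr// => zd; have := normr_ge0 z; nra.
Qed.

(** The test used for all bounds on subgradients: an upper estimate of [g] along a ray, up to a
    quadratic error, bounds <s, d> by its slope. *)
Lemma regular_subdiff_direction g x s d m C t0 : 0 < t0 -> regular_subdiff g x s ->
  (forall t, 0 < t -> t < t0 -> g (x + t *: d) <= g x + m * t + C * t ^+ 2) ->
  '[s, d] <= m.
Proof.
move=> t00 /regular_subdiffP sg h; rewrite leNgt; apply/negP => md.
pose n := '[s, d] - m; have n0 : 0 < n by rewrite subr_gt0.
have d0 := normr_ge0 d; have dp : 0 < `|d| + 1 by lra.
have [dl dl0 hd] := sg _ (divr_gt0 n0 (mulr_gt0 (ltr0Sn R 1) dp)).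
have Cp : 0 < `|C| + 1 by have := normr_ge0 C; lra.
(* The three caps keep [t] below [t0], keep |t d| below [dl], and make the quadratic error less than
   half of n t; the subgradient error takes at most the other half. *)
pose t := Num.min (t0 / 2) (Num.min (dl / (`|d| + 1) / 2) (n / (2 * (`|C| + 1)))).
have tp : 0 < t.
  by rewrite /t !lt_min; apply/and3P; split; rewrite ?divr_gt0// mulr_gt0.
have tt0 : t < t0 by apply: (@le_lt_trans _ _ (t0 / 2)); rewrite ?ge_min ?lexx//; lra.
have td : t * (`|d| + 1) < dl.
  rewrite -ltr_pdivlMr//; apply: (@le_lt_trans _ _ (dl / (`|d| + 1) / 2)).
    by rewrite /t !ge_min lexx orbT.
  by have := divr_gt0 dl0 dp; lra.
have tC : t * (2 * (`|C| + 1)) <= n.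
  by rewrite -ler_pdivlMr ?mulr_gt0// /t !ge_min lexx !orbT.
have : `|t *: d| < dl by rewrite normrZ gtr0_norm//; nra.
move=> /hd; rewrite normrZ gtr0_norm// jdotZr => h1; have h2 := h t tp tt0.
have := le_trans h1 h2.
have e1 : n / (2 * (`|d| + 1)) * (t * `|d|) <= n * t / 2.
  rewrite (_ : n / (2 * (`|d| + 1)) * (t * `|d|) = n * t / 2 * (`|d| / (`|d| + 1))).
    rewrite ler_piMr//; first by have := mulr_gt0 n0 tp; lra.
    by rewrite ler_pdivrMr//; lra.
  by field; rewrite gt_eqF.
have e2 : C * t ^+ 2 < n * t / 2.
  have := ler_norm C; rewrite expr2; have := normr_ge0 C => c0 c1.
  have : C * t * 2 < n by nra.
  by move=> h3; nra.
have -> : '[s, d] = n + m by rewrite /n subrK.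
by nra.
Qed.

End RegularSubdifferential.

(** * Regular subgradients of an eigenvalue function *)

Section RegularEigenvalue.
Context {R : realType} {E : euclideanJordanType R}.
Hypothesis hdot : forall x y : E, jdot x y = jtr (jmul x y).
Implicit Types (x y z u v w s : E).
Local Notation r := (jrank E).

Lemma card_ord_lt m : (m <= r)%N -> #|[pred i : 'I_r | (i < m)%N]| = m.
Proof. by move=> mr; rewrite -sum1_card sum_ord_lt. Qed.

(** Bounds the two counts of [lambda_count] by sets of known size. *)
Lemma lambda_between (c : 'I_r -> E) (b : 'I_r -> R) k t (A B : pred 'I_r) :
  jordan_frame c -> (forall i, t < b i -> A i) -> (forall i, B i -> t <= b i) ->
  (#|A| < k <= #|B|)%N -> lambda k (\sum_i b i *: c i) = t.
Proof.
move=> cf hA hB /andP[Ak Bk]; apply: lambda_count => //; apply/andP; split.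
  by apply: leq_ltn_trans Ak; apply/subset_leq_card/fintype.subsetP => i; exact: hA.
by apply: leq_trans Bk _; apply/subset_leq_card/fintype.subsetP => i; exact: hB.
Qed.

Lemma psd_orth_mul s d : psd s -> idem d -> '[s, d] = 0 -> s ∘ d = 0.
Proof.
move=> ps dd sd; have [c [cf sE _]] := eigen_frame hdot s.
rewrite sE jmul_suml big1// => i _; rewrite jmulZl.
have [->|si] := eqVneq (lambda i.+1 s) 0; first by rewrite scale0r.
by rewrite (psd_orth hdot (b := fun i => lambda i.+1 s) cf sE ps dd sd si) scaler0.
Qed.

Section AtPoint.
Variables (k : nat) (x : E) (c : 'I_r -> E).
Hypothesis kr : (k < r)%N.
Hypothesis xc : sorted_frame x c (fun i => lambda i.+1 x).
Local Notation l := (lambda k.+1 x).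
Local Notation a i := (lambda i.+1 x).

Let cf : jordan_frame c. Proof. by case: xc. Qed.
Let xE : x = \sum_(i < r) a i *: c i. Proof. by case: xc. Qed.

Lemma lambda_gt_index (i : 'I_r) : l < a i -> (i < k)%N.
Proof.
apply: contraTT; rewrite -leqNgt -leNgt => ki.
by apply: (lambda_antitone hdot); rewrite ki ltn_ord.
Qed.

Lemma lambda_ge_index (i : 'I_r) : (i <= k)%N -> l <= a i.
Proof. by move=> ik; apply: (lambda_antitone hdot); rewrite ik. Qed.

Lemma lambda_add_unit t : lambda k.+1 (x + t *: junit) = l + t.
Proof.
have [_ _ ce] := cf.
have -> : x + t *: junit = \sum_(i < r) (a i + t) *: c i.
  rewrite {1}xE -ce scaler_sumr -big_split /=.
  by apply: eq_bigr => i _; rewrite scalerDl.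
apply: (lambda_between (A := fun i => (i < k)%N) (B := fun i => (i < k.+1)%N)) => //.
- by move=> i; rewrite ltrD2r; exact: lambda_gt_index.
- by move=> i ik; rewrite lerD2r lambda_ge_index.
- by rewrite !card_ord_lt ?ltnSn// ltnW.
Qed.

Lemma frame_perturb (i : 'I_r) t :
  x + t *: c i = \sum_(j < r) (a j + t * (j == i)%:R) *: c j.
Proof.
rewrite {1}xE; under [RHS]eq_bigr do rewrite scalerDl.
rewrite big_split /=; congr (_ + _); rewrite (bigD1 i)//= eqxx mulr1 big1 ?addr0//.
by move=> j /negPf ->; rewrite mulr0 scale0r.
Qed.

(** The moved eigenvalue does not reach [l], so it stays on its side. *)
Lemma lambda_perturb_off (i : 'I_r) t : `|t| < `|a i - l| -> lambda k.+1 (x + t *: c i) = l.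
Proof.
move=> ti; rewrite frame_perturb.
apply: (lambda_between (A := fun i => (i < k)%N) (B := fun i => (i < k.+1)%N)) => //.
- move=> j; case: (eqVneq j i) => [->|_]; last by rewrite mulr0 addr0; exact: lambda_gt_index.
  rewrite mulr1 => lt; apply: lambda_gt_index; rewrite ltNge; apply/negP => al.
  move: ti; rewrite (ler0_norm (_ : a i - l <= 0)); last lra.
  by have := ler_norm t; lra.
- move=> j jk; case: (eqVneq j i) => [ji|_]; last by rewrite mulr0 addr0; exact: lambda_ge_index.
  have := lambda_ge_index jk; rewrite ji mulr1 => al.
  move: ti; rewrite (ger0_norm (_ : 0 <= a i - l)); last lra.
  by have := ler_norm (- t); rewrite normrN; lra.
- by rewrite !card_ord_lt ?ltnSn// ltnW.
Qed.

(** As [lambda k x] equals [l], at most k - 1 eigenvalues exceed [l]; raising one more leaves at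
    most [k] above it, so position [k.+1] still holds [l]. *)
Lemma lambda_perturb_block (i : 'I_r) t : (0 < k)%N -> lambda k x = l -> 0 <= t -> a i = l ->
  lambda k.+1 (x + t *: c i) = l.
Proof.
move=> k0 kl t0 ai; rewrite frame_perturb.
apply: (lambda_between (A := [predU1 i & [pred j : 'I_r | (j < k.-1)%N]])
  (B := fun i => (i < k.+1)%N)) => //.
- move=> j; case: (eqVneq j i) => [->|ji] /=; rewrite ?eqxx//.
  rewrite mulr0 addr0 (negPf ji) /= => lj; rewrite inE ltnNge; apply/negP => kj.
  have : a j <= lambda k.-1.+1 x by apply: (lambda_antitone hdot); rewrite kj ltn_ord.
  by rewrite prednK// kl leNgt lj.
- move=> j jk; apply: le_trans (lambda_ge_index jk) _.
  by rewrite lerDl mulr_ge0.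
- rewrite card_ord_lt// leqnn andbT ltnS.
  have -> : #|[predU1 i & [pred j : 'I_r | (j < k.-1)%N]]| =
      ((i \notin [pred j : 'I_r | (j < k.-1)%N]) + k.-1)%N.
    by rewrite cardU1 card_ord_lt// (leq_trans (leq_pred _)) ?(ltnW kr).
  by apply: leq_trans (leq_add (leq_b1 _) (leqnn _)) _; rewrite add1n prednK.
Qed.

Lemma regular_trace s : regular_subdiff (lambda k.+1) x s -> '[s, junit] = 1.
Proof.
move=> rs; apply/eqP; rewrite eq_le; apply/andP; split.
  apply: (regular_subdiff_direction (C := 0) ltr01 rs) => t _ _.
  by rewrite lambda_add_unit mul1r mul0r addr0.
rewrite -lerN2 -jdotNr.
apply: (regular_subdiff_direction (C := 0) ltr01 rs) => t _ _.
by rewrite scalerN -scaleNr lambda_add_unit mulN1r mul0r addr0.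
Qed.

Lemma regular_off_block s (i : 'I_r) : regular_subdiff (lambda k.+1) x s ->
  a i != l -> '[s, c i] <= 0.
Proof.
move=> rs ai; have ail : 0 < `|a i - l| by rewrite normr_gt0 subr_eq0.
apply: (regular_subdiff_direction (C := 0) ail rs) => t t0 tl.
have -> : lambda k.+1 (x + t *: c i) = l by apply: lambda_perturb_off; rewrite gtr0_norm.
by rewrite !mul0r !addr0.
Qed.

Lemma regular_in_block s (i : 'I_r) : (0 < k)%N -> lambda k x = l ->
  regular_subdiff (lambda k.+1) x s -> a i = l -> '[s, c i] <= 0.
Proof.
move=> k0 kl rs ai; apply: (regular_subdiff_direction (C := 0) ltr01 rs) => t t0 _.
have -> : lambda k.+1 (x + t *: c i) = l by apply: lambda_perturb_block => //; exact: ltW.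
by rewrite !mul0r !addr0.
Qed.

Lemma regular_empty s : (0 < k)%N -> lambda k x = l -> ~ regular_subdiff (lambda k.+1) x s.
Proof.
move=> k0 kl rs; have := regular_trace rs; have [_ _ <-] := cf.
rewrite jdot_sumr => h.
suff : \sum_i '[s, c i] <= 0 by rewrite h ler10.
apply: sumr_le0 => i _; have [ai|ai] := eqVneq (a i) l; first exact: regular_in_block.
exact: regular_off_block.
Qed.

Hypothesis gap : (k == 0)%N || (l < lambda k x).

Lemma gap_pos : exists2 g, 0 < g & forall i, (i < k)%N -> l + g <= a i.
Proof.
case: k gap kr => [_ _|m /= lm mr]; first by exists 1.
exists (lambda m.+1 x - lambda m.+2 x); first by rewrite subr_gt0.
move=> i im; rewrite addrC subrK; apply: (lambda_antitone hdot).
by rewrite -ltnS im ltnW.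
Qed.

(* Writing [w = junit - v], one has [v - u = (v - u)^2 - 2 w u], and [|w u|^2 <= '[w, u]] is
   the defect appearing in Ky Fan's inequality. *)
Lemma lambda_sub_idem_le d : idem d ->
  exists C, forall t, 0 <= t -> lambda k.+1 (x - t *: d) <= l + C * t ^+ 2.
Proof.
move=> dd; have [g g0 hg] := gap_pos; exists (`|d| ^+ 2 / g) => t t0.
set u := topsum c k; have uu : idem u by exact: frame_idem_sum.
have uk : '[u, junit] = k%:R by apply: topsum_trace => //; exact: ltnW.
have [v [vv vk sv]] := sigma_max hdot (x - t *: d) kr.
have h1 : lambda k.+1 (x - t *: d) <= '[x - t *: d, v] - '[x - t *: d, u].
  rewrite -sv sigmaS// addrAC lerDr subr_ge0.
  by apply: sigma_ge => //; exact: ltnW.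
pose w := junit - v; have ww : idem w by exact: idem_compl.
have wu : '[w, u] = k%:R - '[u, v] by rewrite /w jdotBl jdotC uk jdotC.
have h2 : g * '[w, u] <= '[x, u] + l - '[x, v].
  rewrite wu (sorted_frame_dot_top hdot k xc) -sigmaS//.
  apply: (ky_fan_gap hdot xc vv vk kr (leqnSn k) hg).
    by move=> i /andP[ki ik]; apply: (lambda_antitone hdot); rewrite -ltnS ik.
  by move=> i /andP[ki ir]; apply: (lambda_antitone hdot); rewrite ir andbT ltnW.
have h3 : - (2 * (`|d| * `|w ∘ u|)) <= '[d, v - u].
  have -> : v - u = (v - u) ∘ (v - u) - 2 *: (w ∘ u).
    rewrite /w !(jmulBl, jmulBr) vv uu jmul1x (jmulC u v).
    by apply: jdot_ext => y; rewrite !jdotE; ring.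
  rewrite jdotBr -jdot_mul jdotZr; have := idem_jdot_ge0 (v - u) dd.
  by have := ler_norm '[d, w ∘ u]; have := jdot_le d (w ∘ u); lra.
have h4 : `|w ∘ u| ^+ 2 <= '[w, u].
  have <- : '[w ∘ u, u] = '[w, u] by rewrite jdot_mul uu.
  rewrite normE (idem_quadratic u ww).2.
  by rewrite lerDl mulr_ge0 ?jdot_ge0.
apply: le_trans h1 _.
have -> : '[x - t *: d, v] - '[x - t *: d, u] = '[x, v] - '[x, u] - t * '[d, v - u].
  by rewrite !jdotE; ring.
set n := `|w ∘ u| in h3 h4; set D := `|d| in h3 *.
have h5 : 2 * t * D * n - g * n ^+ 2 <= D ^+ 2 / g * t ^+ 2.
  have -> : D ^+ 2 / g * t ^+ 2 = (D * t) ^+ 2 / g by rewrite exprMn mulrAC.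
  rewrite ler_pdivlMr//; have := sqr_ge0 (g * n - D * t); rewrite !expr2; lra.
have h6 : g * n ^+ 2 <= g * '[w, u] by rewrite ler_pM2l.
have h7 : t * - (2 * (D * n)) <= t * '[d, v - u] by rewrite ler_wpM2l.
lra.
Qed.

Lemma regular_psd s : regular_subdiff (lambda k.+1) x s -> psd s.
Proof.
move=> rs d dd; have [C hC] := lambda_sub_idem_le dd.
rewrite -oppr_le0 -jdotNr; apply: (regular_subdiff_direction (C := C) ltr01 rs) => t t0 _.
by rewrite scalerN mul0r addr0; apply: hC; exact: ltW.
Qed.

Lemma regular_eigen_face s : regular_subdiff (lambda k.+1) x s -> eigen_face k.+1 x s.
Proof.
move=> rs; have ps := regular_psd rs; split => //; first exact: regular_trace.
apply: (eigen_orth cf xE) => i ai; have [cp _ _] := cf; have [ci _ _] := cp i.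
rewrite jmulC; apply: psd_orth_mul => //; apply/eqP.
by rewrite eq_le ps// andbT; apply: regular_off_block.
Qed.

(** The quadratic lower bound defines a convex set [K], so primitive idempotents [d] suffice. For
    these, [u + d] competes for [sigma k.+1] at [x + z], and the gap controls the distance from [u]
    to the maximizer [v] of [sigma k] there. *)
Lemma eigen_face_regular s : eigen_face k.+1 x s -> regular_subdiff (lambda k.+1) x s.
Proof.
have [g g0 hg] := gap_pos; set u := topsum c k; have uu : idem u by exact: frame_idem_sum.
have uk : '[u, junit] = k%:R by apply: topsum_trace => //; exact: ltnW.
(* The maximum over n of m n - (g / 2) n^2 is m^2 / (2 g). *)
pose C := (2 * g)^-1; have C0 : 0 <= C by rewrite invr_ge0 mulr_ge0 ?ltW.
pose K := [set s | forall z, l + '[s, z] - C * `|z| ^+ 2 <= lambda k.+1 (x + z)].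
suff : eigen_face k.+1 x `<=` K by move=> /(_ s) h /h; exact: regular_subdiff_quadratic.
rewrite -(eigen_face_conv hdot); apply: smallest_sub.
  apply/convex_setP => y z t Ky Kz t0 t1 w; rewrite jdotDl !jdotZl.
  have h1 : l + '[y, w] - C * `|w| ^+ 2 <= lambda k.+1 (x + w) := Ky w.
  have h2 : l + '[z, w] - C * `|w| ^+ 2 <= lambda k.+1 (x + w) := Kz w.
  have h3 := ler_wpM2l t0 h1.
  have t2 : 0 <= 1 - t by rewrite subr_ge0.
  have h4 := ler_wpM2l t2 h2.
  by lra.
move=> d [dp xd] z; have [dd _ _] := dp.
have ud : u ∘ d = 0.
  rewrite /u /topsum jmul_suml big1// => i ik.
  have [cp _ _] := cf; have [ci _ _] := cp i.
  apply: idem_orth => //; rewrite jdotC; apply: (eigen_coef_orth cf xE xd).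
  by have := hg _ ik => hgi; rewrite gt_eqF//; lra.
have udk : '[u + d, junit] = k.+1%:R by rewrite jdotDl uk primitive_trace// -natr1.
have h1 : '[x + z, u + d] <= sigma k.+1 (x + z).
  by apply: sigma_ge => //; exact: idem_add.
have [v [vv vk sv]] := sigma_max hdot (x + z) (ltnW kr).
have ld : '[x, d] = l by rewrite -dd -jdot_mul xd jdotZl primitive_dot// mulr1.
have h2 : g * (k%:R - '[u, v]) <= '[x, u] - '[x, v].
  rewrite (sorted_frame_dot_top hdot k xc).
  apply: (ky_fan_gap hdot xc vv vk (ltnW kr) (leqnn k) hg).
    by move=> i /andP[ki ik]; rewrite ltnNge ki in ik.
  by move=> i /andP[ki ir]; apply: (lambda_antitone hdot); rewrite ki.
have h3 : `|u - v| ^+ 2 = 2 * (k%:R - '[u, v]).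
  rewrite normE !jdotE (jdotC v u) -(idem_unit_dot uu) -(idem_unit_dot vv) uk vk; ring.
have h4 : - (`|z| * `|u - v|) <= '[z, u - v].
  by have := jdot_le z (u - v); rewrite ler_norml => /andP[].
move: h1; rewrite sigmaS// sv !(jdotDl, jdotDr) ld (jdotC z d).
move: h4; rewrite jdotBr => h4 h1.
set n := `|u - v| in h3 h4; set m := `|z| in h4 *.
have h5 : m * n - g / 2 * n ^+ 2 <= C * m ^+ 2.
  rewrite /C [leRHS]mulrC ler_pdivlMr ?mulr_gt0//.
  by have := sqr_ge0 (g * n - m); rewrite !expr2; lra.
have h6 : g / 2 * n ^+ 2 = g * (k%:R - '[u, v]) by rewrite h3; field.
lra.
Qed.

End AtPoint.
End RegularEigenvalue.

(** * Approximate and horizon subdifferentials *)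

Lemma lipschitz_cvg (R : realType) (V W : normedModType R) (f : V -> W) (K : R)
    (u : nat -> V) (x : V) : (forall y z, `|f y - f z| <= K * `|y - z|) ->
  u @ \oo --> x -> (f \o u) @ \oo --> f x.
Proof.
move=> fK /cvgrPdist_lt ux; apply/cvgrPdist_lt => e e0.
have K0 : 0 < `|K| + 1 by rewrite ltr_wpDl.
have := ux _ (divr_gt0 e0 K0); apply: filterS => n /=.
rewrite ltr_pdivlMr// => h; apply: le_lt_trans (fK _ _) _; apply: le_lt_trans h.
by rewrite mulrC ler_wpM2l//; have := ler_norm K; lra.
Qed.

Lemma subset_of_card (I : finType) (D : {set I}) n : (n <= #|D|)%N ->
  exists2 A : {set I}, A \subset D & #|A| = n.
Proof.
move=> nD; exists [set i in take n (enum D)]%SET.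
  by apply/fintype.subsetP => i; rewrite inE => /mem_take; rewrite mem_enum.
rewrite cardsE (card_uniqP _) ?size_takel -?cardE//.
exact/take_uniq/enum_uniq.
Qed.

Section Subdifferentials.
Context {R : realType} {E : euclideanJordanType R}.
Hypothesis hdot : forall x y : E, jdot x y = jtr (jmul x y).
Implicit Types (x y z u v w s : E).
Local Notation r := (jrank E).

(** The alpha of the theorem is [1 + mult_ge k x - k]. *)
Definition mult_ge k x := #|[pred i : 'I_r | (lambda k x <= lambda i.+1 x)%R]|.

Lemma lambda_card (f : 'I_r -> E) (A : 'I_r -> R) (P : pred R) : jordan_frame f ->
  #|[pred i : 'I_r | P (A i)]| = #|[pred i : 'I_r | P (lambda i.+1 (\sum_j A j *: f j))]|.
Proof.
move=> ff; rewrite -[LHS]count_codom -(seq.permP (eigvals_perm hdot A ff)).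
set x := \sum_i _; have [d [df xE _]] := eigen_frame hdot x.
by rewrite {1}xE (seq.permP (eigvals_perm hdot (fun i => lambda i.+1 x) df)) count_codom.
Qed.

Lemma lambda_gt_card k x t : (0 < k)%N ->
  (k <= #|[pred i : 'I_r | (t < lambda i.+1 x)%R]|)%N -> t < lambda k x.
Proof.
case: k => // k _; apply: contraTT; rewrite -leNgt -ltnNge ltnS => kt.
have [kr|rk] := leqP k r; last first.
  by apply: leq_trans (ltnW rk); apply: leq_trans (max_card _) _; rewrite card_ord.
rewrite -(card_ord_lt kr); apply/subset_leq_card/fintype.subsetP => i; rewrite !inE.
apply: contraTT; rewrite -leqNgt -leNgt => ki; apply: le_trans kt.
by apply: (lambda_antitone hdot); rewrite ki ltn_ord.
Qed.

Lemma mult_ge_le k x : (k <= r)%N -> (k <= mult_ge k x)%N.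
Proof.
case: k => // k kr; rewrite -{1}(card_ord_lt kr).
apply/subset_leq_card/fintype.subsetP => i; rewrite !inE => ik.
exact: lambda_ge_index.
Qed.

Lemma mult_split k x : (mult_ge k x = #|[pred i : 'I_r | lambda i.+1 x == lambda k x]| +
  #|[pred i : 'I_r | (lambda k x < lambda i.+1 x)%R]|)%N.
Proof.
rewrite /mult_ge -cardUI [X in (_ = _ + X)%N]eq_card0 ?addn0.
  by apply: eq_card => i; rewrite !inE le_eqVlt eq_sym.
by move=> i; rewrite !inE; case: ltgtP.
Qed.

Lemma card_gt_lambda k x : (0 < k <= r)%N ->
  (#|[pred i : 'I_r | (lambda k x < lambda i.+1 x)%R]| < k)%N.
Proof.
case: k => // k /= kr; rewrite ltnS -{2}(card_ord_lt (ltnW kr)).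
apply/subset_leq_card/fintype.subsetP => i; rewrite !inE.
exact: lambda_gt_index.
Qed.

(** With a gap, at least k - 1 eigenvalues exceed [lambda k x], which bounds the size of its block
    in [eigen_face_rank]. *)
Lemma face_rank_gap k x s : (0 < k <= r)%N -> (k == 1)%N || (lambda k x < lambda k.-1 x) ->
  eigen_face k x s -> (elt_rank s <= 1 + mult_ge k x - k)%N.
Proof.
case: k => // k /= kr gap fs; have [c [cf xE _]] := eigen_frame hdot x.
apply: leq_trans (eigen_face_rank hdot fs cf xE) _.
rewrite mult_split add1n subSS.
suff kg : (k <= #|[pred i : 'I_r | (lambda k.+1 x < lambda i.+1 x)%R]|)%N.
  by rewrite -addnBA// leq_addr.
have : (k <= r)%N by exact: ltnW.
move=> kr'; rewrite -{1}(card_ord_lt kr').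
apply/subset_leq_card/fintype.subsetP => i; rewrite !inE.
case: k gap {fs} kr kr' => // k /= gap kr kr' ik; apply: lt_le_trans gap _.
by apply: (lambda_antitone hdot); rewrite -ltnS ik.
Qed.

(** [s] is a convex combination of primitive idempotents, which have norm 1. *)
Lemma face_norm_le k x s : eigen_face k x s -> `|s| <= 1.
Proof.
move=> [ps s1 _]; have [c [cf sE _]] := eigen_frame hdot s; have [cp _ _] := cf.
rewrite {1}sE; apply: le_trans (ler_norm_sum _ _ _) _.
rewrite -s1 {2}sE jdot_suml; apply: ler_sum => i _.
rewrite normrZ jdotZl (primitive_trace hdot (cp i)) mulr1 ger0_norm; last first.
  exact: (psd_coef hdot (b := fun i => lambda i.+1 s) i cf sE ps).
rewrite -[leRHS]mulr1 ler_wpM2l//.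
  exact: (psd_coef hdot (b := fun i => lambda i.+1 s) i cf sE ps).
have [ci _ _] := cp i; apply: (@idem_norm _ _ _ 1) => //.
exact: primitive_trace.
Qed.

Lemma jdot_cvg (v : nat -> E) s d : v @ \oo --> s -> (fun n => '[v n, d]) @ \oo --> '[s, d].
Proof.
apply: (@lipschitz_cvg _ _ R^o (fun s => '[s, d]) `|d|) => y z.
by rewrite -jdotBl mulrC; exact: jdot_le.
Qed.

Lemma lambda_cvg k (u : nat -> E) x : (0 < k <= r)%N -> u @ \oo --> x ->
  (fun n => lambda k (u n)) @ \oo --> lambda k x.
Proof.
move=> kr; apply: (@lipschitz_cvg _ _ R^o (lambda k) (2 * r%:R)) => y z.
exact: lambda_lipschitz.
Qed.

(** Expresses a rank bound through the continuous function [lambda m.+1], so that it survives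
    limits. *)
Lemma elt_rank_lambda s m : psd s -> (m < r)%N -> (elt_rank s <= m)%N = (lambda m.+1 s <= 0).
Proof.
move=> ps mr; have [c [cf sE _]] := eigen_frame hdot s.
have b0 (i : 'I_r) : 0 <= lambda i.+1 s.
  exact: (psd_coef hdot (b := fun i => lambda i.+1 s) i cf sE ps).
rewrite {1}sE (elt_rank_frame hdot (fun i => lambda i.+1 s) cf).
have -> : #|[pred i : 'I_r | lambda i.+1 s != 0]| = #|[pred i : 'I_r | (0 < lambda i.+1 s)%R]|.
  by apply: eq_card => i; rewrite !inE lt0r b0 andbT.
apply/idP/idP.
  rewrite leqNgt leNgt; apply: contra => m0.
  rewrite -{1}(card_ord_lt mr); apply/subset_leq_card/fintype.subsetP => i; rewrite !inE => im.
  by apply: lt_le_trans m0 _; apply: (lambda_antitone hdot); rewrite mr andbT.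
by rewrite leqNgt leNgt; apply: contra => mm; exact: lambda_gt_card.
Qed.

Lemma elt_rank_le s : (elt_rank s <= r)%N.
Proof. by rewrite -(size_eigvals hdot s) /elt_rank count_size. Qed.

Lemma elt_rank_closed (v : nat -> E) s m : v @ \oo --> s -> psd s -> (forall n, psd (v n)) ->
  (\forall n \near \oo, (elt_rank (v n) <= m)%N) -> (elt_rank s <= m)%N.
Proof.
move=> vs ps pv vm; have [rm|mr] := leqP r m.
  exact: leq_trans (elt_rank_le s) rm.
rewrite elt_rank_lambda//.
have ls : (fun n => lambda m.+1 (v n)) @ \oo --> lambda m.+1 s by exact: lambda_cvg.
apply: (ler_cvg_to ls (cvg_cst 0)).
by apply: filterS vm => n; rewrite elt_rank_lambda.
Qed.

Lemma eigen_face_closed k (u v : nat -> E) x s : (0 < k <= r)%N ->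
  u @ \oo --> x -> v @ \oo --> s -> (forall n, eigen_face k (u n) (v n)) ->
  eigen_face k x s.
Proof.
move=> kr ux vs fn; split.
- move=> d dd; apply: (ler_cvg_to (cvg_cst 0) (jdot_cvg vs)).
  by apply: nearW => n; have [+ _ _] := fn n; apply.
- have h := @jdot_cvg v s junit vs.
  have e : (fun n => '[v n, junit]) = cst (1 : R) by apply/funext => n; have [] := fn n.
  by rewrite e in h; exact: (cvg_unique _ h (cvg_cst _)).
apply/eqP; rewrite -subr_eq0 -normr_le0.
pose K := r%:R * `|x| + `|lambda k x|.
(* The factor 3 r adds the constant r of [jmul_le] to the constant 2 r of [lambda_lipschitz]. *)
have le_n n : `|x ∘ s - lambda k x *: s| <= K * `|v n - s| + 3 * r%:R * `|u n - x|.
  have [_ _ uv] := fn n; have v1 := face_norm_le (fn n).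
  have -> : x ∘ s - lambda k x *: s = - (x ∘ (v n - s)) + lambda k x *: (v n - s)
      + (- ((u n - x) ∘ v n) + (lambda k (u n) - lambda k x) *: v n).
    rewrite !(jmulBl, jmulBr) uv.
    by apply: jdot_ext => w; rewrite !jdotE; ring.
  apply: le_trans (ler_normD _ _) _; apply: lerD.
    apply: le_trans (ler_normD _ _) _; rewrite /K mulrDl normrN normrZ lerD2r.
    exact: jmul_le.
  apply: le_trans (ler_normD _ _) _; rewrite normrN normrZ.
  have h1 := jmul_le hdot (u n - x) (v n).
  have h2 := lambda_lipschitz hdot (u n) x kr.
  have h3 : r%:R * `|u n - x| * `|v n| <= r%:R * `|u n - x|.
    by rewrite ler_piMr// mulr_ge0.
  have h4 : `|lambda k (u n) - lambda k x| * `|v n| <= `|lambda k (u n) - lambda k x|.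
    by rewrite ler_piMr.
  lra.
have lim0 : (fun n => K * `|v n - s| + 3 * r%:R * `|u n - x|) @ \oo -->
    K * (0 : R) + 3 * r%:R * 0.
  have d0 (w : nat -> E) y : w @ \oo --> y -> (fun n => `|w n - y|) @ \oo --> (0 : R).
    move=> wy; rewrite -(normr0 E) -(subrr y); apply: cvg_norm.
    by apply: cvgB => //; exact: cvg_cst.
  by apply: cvgD; apply: cvgM; (exact: cvg_cst || exact: d0).
rewrite !mulr0 addr0 in lim0; apply: (ler_cvg_to (cvg_cst _) lim0).
by apply: nearW => n; exact: le_n.
Qed.

(** Strict inequalities between eigenvalues at [x] persist nearby by continuity. *)
Lemma mult_ge_near k (u : nat -> E) x : (0 < k <= r)%N -> u @ \oo --> x ->
  \forall n \near \oo, (mult_ge k (u n) <= mult_ge k x)%N.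
Proof.
move=> kr ux.
have : \forall n \near \oo, forall i : 'I_r,
    lambda i.+1 x < lambda k x -> lambda i.+1 (u n) < lambda k (u n).
  apply: filter_forall => i; have [ik|] := boolP (lambda i.+1 x < lambda k x); last first.
    by move=> _; apply: nearW.
  have : (fun n => lambda k (u n) - lambda i.+1 (u n)) @ \oo --> lambda k x - lambda i.+1 x.
    by apply: cvgB; apply: lambda_cvg => //=.
  move=> /cvgr_gt/(_ 0); rewrite subr_gt0 => /(_ ik); apply: filterS => n.
  by rewrite subr_gt0.
apply: filterS => n h; apply/subset_leq_card/fintype.subsetP => i; rewrite !inE.
by apply: contraTT; rewrite -!ltNge; exact: h.
Qed.

Lemma regular_nonempty_gap k x s : (0 < k <= r)%N -> regular_subdiff (lambda k) x s ->
  (k == 1)%N || (lambda k x < lambda k.-1 x).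
Proof.
case: k => // k kr rs; apply: contrapT => /negP; rewrite negb_or -leNgt => /andP[k1 kl].
have [c xc] := eigen_frame hdot x; apply: (regular_empty hdot kr xc _ _ rs).
  by case: k k1 {kr rs kl}.
apply/eqP; rewrite eq_le kl /=; case: k k1 kr {rs kl} => // k _ kr.
by apply: (lambda_antitone hdot); rewrite leqnSn.
Qed.

Lemma regular_subset_face k x : (0 < k <= r)%N ->
  regular_subdiff (lambda k) x `<=` eigen_face k x.
Proof.
move=> kr s rs; have gap := regular_nonempty_gap kr rs.
case: k kr rs gap => // k kr rs gap; have [c xc] := eigen_frame hdot x.
exact: (regular_eigen_face hdot kr xc).
Qed.

Lemma regular_eq_face k x : (0 < k <= r)%N -> (k == 1)%N || (lambda k x < lambda k.-1 x) ->
  regular_subdiff (lambda k) x = eigen_face k x.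
Proof.
move=> kr gap; apply/seteqP; split; first exact: regular_subset_face.
case: k kr gap => // k kr gap s fs; have [c xc] := eigen_frame hdot x.
exact: (eigen_face_regular hdot kr xc).
Qed.

Lemma approx_subset k x : (0 < k <= r)%N ->
  approx_subdiff (lambda k) x `<=`
  [set s | eigen_face k x s /\ (elt_rank s <= 1 + mult_ge k x - k)%N].
Proof.
move=> kr s [u [v [ux vs _ uv]]].
have fn n : eigen_face k (u n) (v n) by apply: regular_subset_face.
have fs : eigen_face k x s by exact: eigen_face_closed ux vs fn.
split=> //; apply: (elt_rank_closed vs); first by case: fs.
  by move=> n; case: (fn n).
apply: filterS (mult_ge_near kr ux) => n un.
apply: leq_trans (face_rank_gap kr (regular_nonempty_gap kr (uv n)) (fn n)) _.
by rewrite leq_sub2r// leq_add2l.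
Qed.

End Subdifferentials.

(** * Constructing approximate subgradients *)

Section ApproximateSubdifferential.
Context {R : realType} {E : euclideanJordanType R}.
Hypothesis hdot : forall x y : E, jdot x y = jtr (jmul x y).
Implicit Types (x y z u v w s : E).
Local Notation r := (jrank E).

Lemma simultaneous_frame k x s : eigen_face k x s ->
  exists (f : 'I_r -> E) (A B : 'I_r -> R),
    [/\ jordan_frame f, x = \sum_j A j *: f j, s = \sum_j B j *: f j &
        forall j, B j != 0 -> A j = lambda k x].
Proof.
move=> fs; have [ps s1 xs] := fs; set t := lambda k x.
have [c [cf xE _]] := eigen_frame hdot x; have [d [df sE _]] := eigen_frame hdot s.
set a := fun i : 'I_r => lambda i.+1 x in xE; set b := fun i : 'I_r => lambda i.+1 s in sE.
have [cp co ce] := cf; have [dp do_ _] := df.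
have [ci di] : (forall i, idem (c i)) /\ (forall i, idem (d i)).
  by split=> i; [case: (cp i)|case: (dp i)].
(* The frame refines the eigenvectors [c i] of [x] for eigenvalues other than [t], the
   eigenvectors [d j] spanning the support of [s], and the complement of their sum. *)
pose e0 (o : 'I_r + 'I_r) : E := match o with
  | inl i => if a i != t then c i else 0
  | inr j => if b j != 0 then d j else 0 end.
have idem0 : idem (0 : E) by exact: jmul0l.
have e0i o : idem (e0 o) by case: o => i /=; case: ifP.
have cd i j : a i != t -> b j != 0 -> c i ∘ d j = 0.
  move=> ai bj; rewrite jmulC; apply: (psd_orth hdot df sE ps (ci i) _ bj).
  exact: (eigen_coef_orth cf xE xs ai).
have e0o o o' : o != o' -> e0 o ∘ e0 o' = 0.
  case: o o' => [i|i] [j|j] /= oo; case: ifP => hi; case: ifP => hj;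
    rewrite ?jmul0l ?jmul0r//.
  - by apply: co; apply: contraNneq oo => ->.
  - exact: cd.
  - by rewrite jmulC cd.
  - by apply: do_; apply: contraNneq oo => ->.
pose W := \sum_o e0 o.
have WW : idem W by apply: idem_sum => // o o' _ _; exact: e0o.
have We o : W ∘ e0 o = e0 o.
  rewrite /W jmul_suml (bigD1 o)//= e0i big1 ?addr0// => o' oo'; exact: e0o.
pose e1 (o : option ('I_r + 'I_r)) : E := if o is Some o then e0 o else junit - W.
have e1i o : idem (e1 o) by case: o => [q|] //=; exact: idem_compl.
have e1o o o' : o != o' -> e1 o ∘ e1 o' = 0.
  case: o o' => [q|] [q'|] //= oo.
  - by apply: e0o; apply: contraNneq oo => ->.
  - by rewrite jmulBr jmulx1 jmulC We subrr.
  - by rewrite jmulBl jmul1x We subrr.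
have sumo (F : option ('I_r + 'I_r) -> E) : \sum_o F o =
    F None + (\sum_i F (Some (inl i)) + \sum_j F (Some (inr j))).
  rewrite (bigD1 None)//=; congr (_ + _).
  rewrite (reindex_omap Some id) /=; last by case.
  under eq_bigl do rewrite eqxx.
  by rewrite big_sumType.
have Wsum : W = \sum_i e0 (inl i) + \sum_j e0 (inr j) by rewrite /W big_sumType.
have e1s : \sum_o e1 o = junit.
  rewrite sumo; transitivity (junit - W + W); last exact: subrK.
  by congr (_ + _); rewrite [RHS]Wsum.
have [m [f [p [ff eE]]]] := orth_idem_refine e1i e1o e1s.
have mr := frame_jrank hdot ff; subst m.
(* On the support of [s] and on the complement, [x] acts as [t]. *)
pose A (o : option ('I_r + 'I_r)) := if o is Some (inl i) then a i else t.
pose B (o : option ('I_r + 'I_r)) := if o is Some (inr j) then b j else 0.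
have AE (G : option ('I_r + 'I_r) -> R) : \sum_o G o *: e1 o = \sum_j G (p j) *: f j.
  rewrite [RHS](partition_big p xpredT)//=; apply: eq_bigr => o _.
  by rewrite eE scaler_sumr; apply: eq_bigr => j /eqP ->.
exists f, (A \o p), (B \o p); split => //.
- have hx : x = t *: junit + \sum_i (a i - t) *: e0 (inl i).
    rewrite -ce scaler_sumr -big_split {1}xE; apply: eq_bigr => i _ /=.
    rewrite -/(a i); have [->|_] := eqVneq (a i) t; first by rewrite subrr scale0r addr0.
    by rewrite -scalerDl addrC subrK.
  rewrite -AE sumo {1}hx /B /A /e1 -[X in _ + (_ + X)]scaler_sumr Wsum.
  under eq_bigr do rewrite scalerBl.
  rewrite sumrB -scaler_sumr; apply: jdot_ext => w; rewrite !jdotE; ring.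
- rewrite -AE sumo /= scale0r add0r big1 ?add0r => [|i _]; last by rewrite scale0r.
  rewrite [LHS]sE; apply: eq_bigr => j _.
  by rewrite -/(b j); have [->|//] := eqVneq (b j) 0; rewrite !scale0r.
- by move=> j /=; case: (p j) => [[i|i]|] //=; rewrite eqxx.
Qed.

Lemma approx_superset k x s : (0 < k <= r)%N -> eigen_face k x s ->
  (elt_rank s <= 1 + mult_ge k x - k)%N -> approx_subdiff (lambda k) x s.
Proof.
move=> kr fs rk; have [ps s1 xs] := fs; have /andP[k0 kr'] := kr.
have [f [A [B [ff xE sE AB]]]] := simultaneous_frame fs; set t := lambda k x in AB.
pose N := #|[pred i | (t < A i)%R]|.
pose D := [set i | (A i == t) && (B i == 0)]%SET.
have NE : N = #|[pred i : 'I_r | (t < lambda i.+1 x)%R]|.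
  by rewrite /N (lambda_card hdot A (fun a => t < a) ff) -xE.
have Nk : (N < k)%N by rewrite NE; exact: card_gt_lambda.
have gE : mult_ge k x = #|[pred i | (t <= A i)%R]|.
  by rewrite (lambda_card hdot A (fun a => t <= a) ff) -xE.
have gk : (k <= mult_ge k x)%N by exact: mult_ge_le.
have rE : elt_rank s = #|[pred i | B i != 0]| by rewrite {1}sE elt_rank_frame.
have splitE : (mult_ge k x = #|D| + elt_rank s + N)%N.
  rewrite gE rE /N -cardUI [X in (_ + X + _)%N]eq_card0 ?addn0; last first.
    by move=> i; rewrite !inE; case: (B i == 0); rewrite ?andbF.
  rewrite -cardUI [X in (_ = _ + X)%N]eq_card0 ?addn0; last first.
    move=> i; rewrite !inE; apply/negP => /andP[/orP[/andP[/eqP -> _]|/AB ->]]; by rewrite ltxx.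
  apply: eq_card => i; rewrite !inE le_eqVlt eq_sym.
  case: (boolP (B i == 0)) => [|/AB ->]; rewrite ?andbT ?orbF//.
  by rewrite eqxx.
(* The rank bound is what makes room: with [splitE] it gives [k.-1 - N <= #|D|]. *)
have [|P PD cardP] := @subset_of_card _ D (k.-1 - N).
  by move: k0 Nk rk gk splitE; clear; lia.
have PA i : i \in P -> A i = t /\ B i = 0.
  by move/(fintype.subsetP PD); rewrite inE => /andP[/eqP ? /eqP ?].
(* Raising exactly [k.-1 - N] eigenvalues of the block of [t], all off the support of [s],
   opens a gap above [lambda k] and keeps [s] in the eigen-face. *)
pose h n : R := n.+1%:R^-1.
have h0 n : 0 < h n by rewrite invr_gt0.
pose u n := \sum_j (A j + h n * (j \in P)%:R) *: f j.
have cu n : #|[pred i | (t < A i + h n * (i \in P)%:R)%R]| = k.-1.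
  have -> : #|[pred i | (t < A i + h n * (i \in P)%:R)%R]| = (N + #|P|)%N.
    rewrite /N -cardUI [X in (_ = _ + X)%N]eq_card0 ?addn0; last first.
      by move=> i; rewrite !inE; apply/negP => /andP[lti /PA[ai _]]; rewrite ai ltxx in lti.
    apply: eq_card => i; rewrite !inE; case: (boolP (i \in P)) => [/PA[-> _]|_].
      by rewrite mulr1 ltrDl h0 orbT.
    by rewrite mulr0 addr0 orbF.
  by rewrite cardP; move: k0 Nk; clear; lia.
have lu n : lambda k (u n) = t.
  apply: lambda_count => //; apply/andP; split; first by rewrite cu prednK.
  apply: leq_trans gk _; rewrite gE; apply/subset_leq_card/fintype.subsetP => i.
  by rewrite !inE => /le_trans; apply; rewrite lerDl mulr_ge0 ?(ltW (h0 n)).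
have uE n : u n = x + h n *: \sum_(j in P) f j.
  rewrite xE scaler_sumr [X in _ + X]big_mkcond -big_split; apply: eq_bigr => j _ /=.
  by rewrite scalerDl; case: ifP => _; rewrite ?mulr1 ?mulr0 ?scale0r.
exists u, (fun=> s); split.
- have hw : (h n *: \sum_(j in P) f j) @[n --> \oo] --> 0 *: \sum_(j in P) f j.
    by apply: cvgZr_tmp; exact: (@cvg_harmonic R).
  have -> : u = (fun n => x + h n *: \sum_(j in P) f j) by apply/funext.
  have := cvgD (cvg_cst x) hw; rewrite scale0r addr0; apply.
- exact: cvg_cst.
- rewrite (_ : lambda k \o u = cst t); first exact: cvg_cst.
  by apply/funext => n /=.
move=> n; rewrite regular_eq_face//.
  split => //; rewrite lu; apply: (eigen_orth ff (erefl (u n))) => i.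
  rewrite jmulC sE (orth_system_mul _ _ (frame_orth_system ff)).
  have [->|/AB ->] := eqVneq (B i) 0; first by rewrite scale0r.
  case: (boolP (i \in P)) => [/PA[_ ->]|_]; first by rewrite scale0r.
  by rewrite mulr0 addr0 eqxx.
rewrite lu; have [//|k1] := eqVneq k 1%N.
apply: (lambda_gt_card hdot); first by move: k0 k1; clear; lia.
by rewrite -(lambda_card hdot _ (fun a => t < a) ff) cu.
Qed.

Lemma convex_hull_convex (S : set E) : @convex_set R E (convex_hull S).
Proof.
apply/convex_setP => y z t Sy Sz t0 t1 A [cA SA].
by apply: (convex_setP A).1 => //; [exact: Sy|exact: Sz].
Qed.

(** The eigenvalues of an idempotent are 0 or 1, so its rank equals its trace. *)
Lemma primitive_elt_rank (c : E) : primitive_idempotent c -> elt_rank c = 1%N.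
Proof.
move=> cp; have [cc _ _] := cp; have [d [df cE _]] := eigen_frame hdot c.
set b := fun i : 'I_r => lambda i.+1 c in cE; have [dp _ _] := df.
have b01 i : b i = (b i != 0)%:R.
  have h : b i = b i * b i.
    have bE : '[c, d i] = b i by rewrite {1}cE (frame_coef hdot b).
    rewrite -{1}bE -{1}cc jdot_mul {2}cE (orth_system_mul b i (frame_orth_system df)).
    by rewrite jdotZr bE.
  have [->|bi] := eqVneq (b i) 0; first by [].
  by apply: (mulfI bi); rewrite -h mulr1.
suff : (elt_rank c)%:R = '[c, junit].
  by rewrite primitive_trace// => /eqP; rewrite -[X in _ == X]/(1%:R) eqr_nat => /eqP.
rewrite {1}cE elt_rank_frame// {2}cE jdot_suml -sum1_card natr_sum big_mkcond.
apply: eq_bigr => i _.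
by rewrite jdotZl primitive_trace// mulr1 [RHS]b01 inE; case: ifP.
Qed.

End ApproximateSubdifferential.

Theorem theorem25 (R : realType) (E : euclideanJordanType R)
    (hdot : forall x y : E, jdot x y = jtr (jmul x y))
    (k : nat) (hk : (1 <= k <= jrank E)%N) (x : E) :
  let alpha := (1 + #|[set i : 'I_(jrank E) | (lambda k x <= lambda i.+1 x)%R]%SET|
                - k)%N in
  [/\ clarke_subdiff (lambda k) x =
        convex_hull [set c | primitive_idempotent c /\ jmul x c = lambda k x *: c],
      regular_subdiff (lambda k) x =
        (if (k == 1%N) || (lambda k x < lambda k.-1 x)
         then clarke_subdiff (lambda k) x else set0),
      horizon_subdiff (lambda k) x = [set 0] &
      approx_subdiff (lambda k) x =
        [set s | clarke_subdiff (lambda k) x s /\ (elt_rank s <= alpha)%N]].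
Proof.
move=> alpha; have aE : alpha = (1 + mult_ge k x - k)%N by rewrite /alpha cardsE.
(* Primitive idempotents have rank 1 <= alpha; they generate the hull, so the rank restriction
   disappears under convexification. *)
have prim_approx c : primitive_idempotent c -> x ∘ c = lambda k x *: c ->
    approx_subdiff (lambda k) x c.
  move=> cp xc; apply: approx_superset => //.
    by rewrite -(eigen_face_conv hdot); apply: sub_gen_smallest.
  rewrite primitive_elt_rank// -addnBA ?leq_addr//.
  by apply: mult_ge_le => //; case/andP: hk.
have cE : clarke_subdiff (lambda k) x = eigen_face k x.
  apply/seteqP; split; rewrite -(eigen_face_conv hdot).
    apply: smallest_sub; last by rewrite eigen_face_conv// => s /(approx_subset hdot hk)[].
    exact: convex_hull_convex.
  by apply: sub_smallest2r => [|c [cp xc]]; [exact: convex_hull_convex|exact: prim_approx].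
split.
- by rewrite cE eigen_face_conv.
- case: ifPn => gap; first by rewrite cE (regular_eq_face hdot hk gap).
  apply/seteqP; split => // s /(regular_nonempty_gap hdot hk).
  by rewrite (negPf gap).
- apply/seteqP; split.
    (* Regular subgradients have norm at most 1, so scaling them by [t n] sends them to 0. *)
    move=> s [u [v [t [_ uv [t0 _ tlim] tv]]]].
    apply/eqP; rewrite -normr_le0.
    have tvn : (fun n => `|t n *: v n|) @ \oo --> `|s| by exact: cvg_norm.
    apply: (ler_cvg_to tvn tlim); apply: nearW => n.
    rewrite normrZ gtr0_norm// ler_piMr ?(ltW (t0 n))//.
    exact: (face_norm_le hdot (regular_subset_face hdot hk (uv n))).
  (* Some regular subgradients near [x] are required: those approximating the frame member at
     position [k.-1], counted from 0, are scaled by the harmonic sequence. *)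
  move=> _ ->; have [c [cf xE _]] := eigen_frame hdot x; have [cp _ _] := cf.
  have [k0 kr] := andP hk; have km : (k.-1 < jrank E)%N by rewrite prednK.
  have xc : x ∘ c (Ordinal km) = lambda k x *: c (Ordinal km).
    rewrite {1}xE (orth_system_mul (fun i => lambda i.+1 x) _ (frame_orth_system cf)) /=.
    by rewrite prednK.
  have [u [v [ux vs lu uv]]] := prim_approx _ (cp _) xc.
  exists u, v, harmonic; split => //.
    split => [n|m n mn|]; [exact: harmonic_gt0| |exact: (@cvg_harmonic R)].
    by rewrite /harmonic /= lef_pV2 ?posrE// ler_nat.
  by rewrite -[X in _ --> X](scale0r (c (Ordinal km))); apply: cvgZ => //; exact: (@cvg_harmonic R).
apply/seteqP; split => s.
  by move=> /(approx_subset hdot hk) [fs rs]; rewrite /= cE aE.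
by rewrite /= cE aE => -[fs rs]; exact: approx_superset.
Qed.
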